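(* Let $X=(X_1,\ldots,X_m)$ be real smooth vector fields defined on an open connected domain $W\subset\mathbb{R}^n$ ($n\ge 2$) satisfying Hörmander's condition in $W$, and let $\Omega\subset\subset W$ be a bounded open domain with smooth boundary. Then the first Dirichlet eigenvalue $\lambda_1$ of the self-adjoint operator $-\triangle_X$ on $\Omega$ is positive. Moreover, $$\lambda_1\int_\Omega|u|^2\,dx\le\int_\Omega|Xu|^2\,dx\qquad\forall u\in H^1_{X,0}(\Omega).$$
   Context: Hörmander's condition in $W$: the vector fields $X_1,\ldots,X_m$ together with their commutators up to a certain fixed length span the tangent space at each point of $W$. $X_i^*$ is the formal adjoint of $X_i$, $\triangle_X:=-\sum_{i=1}^m X_i^*X_i$, and $Xu=(X_1u,\ldots,X_mu)$. Function spaces: $H^1_X(W)=\{u\in L^2(W): X_ju\in L^2(W),\ j=1,\ldots,m\}$ with norm $\|u\|^2_{H^1_X(W)}=\|u\|^2_{L^2(W)}+\|Xu\|^2_{L^2(W)}$; $H^1_{X,0}(\Omega)$ is the closure of $C_0^\infty(\Omega)$ in $H^1_X(W)$, with the same norm. First Dirichlet eigenvalue: $\lambda_1=\inf\{\|X\varphi\|^2_{L^2(\Omega)}:\varphi\in H^1_{X,0}(\Omega),\ \|\varphi\|_{L^2(\Omega)}=1\}$. *)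

(* Defs.v *)
From HB Require Import structures.
From mathcomp Require Import all_boot all_order all_algebra.
From mathcomp Require Import all_classical all_reals all_analysis.

Set Implicit Arguments.
Unset Strict Implicit.
Unset Printing Implicit Defensive.

Import Order.TTheory GRing.Theory Num.Theory.
Import numFieldNormedType.Exports.

Local Open Scope classical_set_scope.
Local Open Scope ring_scope.

(* The library has Lebesgue measure on R only, and no sigma-algebra on 'rV_n.
   'rV_n gets the product sigma-algebra (the Borel sets when T is R), as the
   library does for n.-tuple T; see lebesgue_rV below. *)

Definition measure_rV_display : measure_display -> measure_display.
Proof. exact. Qed.

Section measurable_rV.
Context {d : measure_display} {T : measurableType d}.
Variable n : nat.

Let coors : 'I_n -> 'rV[T]_n -> T := fun i v => v ord0 i.

Let rV_set0 : g_sigma_preimage coors set0.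
Proof. exact: sigma_algebra0. Qed.

Let rV_setC A : g_sigma_preimage coors A -> g_sigma_preimage coors (~` A).
Proof. exact: sigma_algebraC. Qed.

Let rV_bigcup (F : _^nat) : (forall i, g_sigma_preimage coors (F i)) ->
  g_sigma_preimage coors (\bigcup_i (F i)).
Proof. exact: sigma_algebra_bigcup. Qed.

HB.instance Definition _ := @isMeasurable.Build (measure_rV_display d)
  'rV[T]_n (g_sigma_preimage coors) rV_set0 rV_setC rV_bigcup.

End measurable_rV.

Lemma measurable_coor d (T : measurableType d) n (i : 'I_n) :
  measurable_fun [set: 'rV[T]_n] (fun v => v ord0 i).
Proof.
move=> _ Y mY; rewrite setTI; apply: sub_sigma_algebra => /=.
rewrite -bigcup_seq/=; exists i => /=; first by rewrite mem_index_enum.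
by exists Y => //; rewrite setTI.
Qed.

Lemma measurable_fun_rVP d1 d2 (T1 : measurableType d1)
    (T2 : measurableType d2) n (f : T1 -> 'rV[T2]_n) :
  (forall i, measurable_fun [set: T1] (fun x => f x ord0 i)) ->
  measurable_fun [set: T1] f.
Proof.
move=> mf.
have : g_sigma_preimage (fun i => (fun v : 'rV[T2]_n => v ord0 i) \o f)
    `<=` measurable.
  apply: smallest_sub; first exact: sigma_algebra_measurable.
  case: n => [|n] in f mf *; first by rewrite big_ord0.
  rewrite -bigcup_mkord_ord; apply: bigcup_sub => i Ii.
  by move=> A [B mB <-]; exact: mf.
by rewrite g_sigma_preimage_comp => prefS _ A mA; apply: prefS; exists A.
Qed.


Section lebesgue_rV.
Context {R : realType}.

Definition rV_cons n (p : measurableTypeR R * 'rV[R]_n) : 'rV[R]_n.+1 :=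
  row_mx (p.1 : R)%:M p.2.

Definition rV_uncons n (v : 'rV[R]_n.+1) : measurableTypeR R * 'rV[R]_n :=
  (v ord0 ord0, \row_i v ord0 (lift ord0 i)).

Lemma rV_consK n : cancel (@rV_cons n) (@rV_uncons n).
Proof.
move=> [x v]; congr pair.
  by rewrite mxE; case: splitP => // j _; rewrite !ord1 mxE mulr1n.
apply/rowP => i; rewrite !mxE; case: splitP => j /=.
  by rewrite ord1.
by rewrite /bump => -[ij]; congr (v _ _); exact/val_inj.
Qed.

Lemma measurable_rV_cons n :
  measurable_fun [set: measurableTypeR R * 'rV[R]_n] (@rV_cons n).
Proof.
apply: measurable_fun_rVP => i; case: (unliftP ord0 i) => [j|] ->{i}.
  have -> : (fun p => @rV_cons n p ord0 (lift ord0 j)) =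
            (fun v : 'rV[R]_n => v ord0 j) \o snd.
    apply/funext => p; have /(congr1 (fun q : _ * 'rV[R]_n => q.2 ord0 j)) := rV_consK p.
    by rewrite mxE.
  exact: measurableT_comp (measurable_coor j) measurable_snd.
have -> : (fun p => @rV_cons n p ord0 ord0) =
          (fst : measurableTypeR R * 'rV[R]_n -> R).
  by apply/funext => p; have /(congr1 fst) := rV_consK p.
exact: measurable_fst.
Qed.

Lemma measurable_rV_uncons n :
  measurable_fun [set: 'rV[R]_n.+1] (@rV_uncons n).
Proof.
apply: measurable_fun_pair; first exact: measurable_coor.
apply: measurable_fun_rVP => i; under eq_fun do rewrite mxE.
exact: measurable_coor.
Qed.

Section cons_measure.
Variables (n : nat) (m : {sigma_finite_measure set 'rV[R]_n -> \bar R}).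

Definition rV_cons_measure :=
  pushforward (@lebesgue_measure R \x m)%E (@rV_cons n).

Let cons_measure0 : rV_cons_measure set0 = 0%E.
Proof. by rewrite /rV_cons_measure /pushforward preimage_set0 measure0. Qed.

Let cons_measure_ge0 A : (0 <= rV_cons_measure A)%E.
Proof. by rewrite /rV_cons_measure /pushforward measure_ge0. Qed.

Let cons_measure_sigma_additive : semi_sigma_additive rV_cons_measure.
Proof.
have mcons A : measurable A -> measurable (@rV_cons n @^-1` A).
  by move=> mA; rewrite -[X in measurable X]setTI; exact: measurable_rV_cons.
move=> F mF tF mUF; rewrite /rV_cons_measure /pushforward preimage_bigcup.
apply: measure_semi_sigma_additive.
- by move=> k; exact: mcons.
- apply/trivIsetP => /= i j _ _ ij; rewrite -preimage_setI.
  by move/trivIsetP : tF => /(_ _ _ _ _ ij) ->//; rewrite preimage_set0.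
- by rewrite -preimage_bigcup; exact: mcons.
Qed.

HB.instance Definition _ := isMeasure.Build _ _ _ rV_cons_measure
  cons_measure0 cons_measure_ge0 cons_measure_sigma_additive.

Let cons_measure_sigma_finite : sigma_finite setT rV_cons_measure.
Proof.
have /sigma_finiteP[F [TF ndF Foo]] := sigma_finiteT (@lebesgue_measure R).
have /sigma_finiteP[G [TG ndG Goo]] := sigma_finiteT m.
exists (fun k => @rV_uncons n @^-1` (F k `*` G k)).
  rewrite -preimage_bigcup -(preimage_setT (@rV_uncons n)).
  congr (_ @^-1` _); apply/esym; rewrite -subTset => -[x y] _.
  have [i _ Fix] : (\bigcup_i F i) x by rewrite -TF.
  have [j _ Gjy] : (\bigcup_i G i) y by rewrite -TG.
  exists (maxn i j) => //; split => /=.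
    by move: x Fix; exact/subsetPset/ndF/leq_maxl.
  by move: y Gjy; exact/subsetPset/ndG/leq_maxr.
move=> k; have [mF ?] := Foo k; have [mG ?] := Goo k; split.
  rewrite -[X in measurable X]setTI; apply: measurable_rV_uncons => //.
  exact: measurableX.
rewrite /rV_cons_measure /pushforward -comp_preimage (_ : _ \o _ = id); last first.
  by apply/funext => p; exact: rV_consK.
by rewrite preimage_id product_measure1E// lte_mul_pinfty// ge0_fin_numE.
Qed.

HB.instance Definition _ := Measure_isSigmaFinite.Build _ _ _ rV_cons_measure
  cons_measure_sigma_finite.

End cons_measure.

(* Lebesgue measure on R^n, see lebesgue_rV_box. *)
Fixpoint lebesgue_rV n : {sigma_finite_measure set 'rV[R]_n -> \bar R} :=
  if n is k.+1 then rV_cons_measure (lebesgue_rV k) else \d_(0 : 'rV[R]_0).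

Lemma lebesgue_rV_box n (a b : 'rV[R]_n) :
  (forall i, a ord0 i <= b ord0 i) ->
  lebesgue_rV n [set v | forall i, v ord0 i \in `[a ord0 i, b ord0 i]] =
  (\prod_i (b ord0 i - a ord0 i))%:E.
Proof.
elim: n => [|n IH] in a b * => ab.
  rewrite big_ord0 /= diracE mem_set//=.
  by case.
pose a' : 'rV[R]_n := \row_i a ord0 (lift ord0 i).
pose b' : 'rV[R]_n := \row_i b ord0 (lift ord0 i).
pose B := [set v : 'rV[R]_n | forall i, v ord0 i \in `[a' ord0 i, b' ord0 i]].
have mB : measurable B.
  rewrite (_ : B = \bigcap_(i : 'I_n)
      ((fun v : 'rV[R]_n => v ord0 i) @^-1` `[a' ord0 i, b' ord0 i])); last first.
    by apply/seteqP; split => v /= Bv i => [_|]; exact: Bv.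
  apply: fin_bigcap_measurable => // i _.
  by rewrite -[X in measurable X]setTI; exact: measurable_coor.
rewrite [LHS]/= /rV_cons_measure /pushforward.
rewrite (_ : _ @^-1` _ =
    ([set` `[a ord0 ord0, b ord0 ord0]] : set (measurableTypeR R)) `*` B); last first.
  apply/seteqP; split => -[x v].
    have xv := rV_consK (x, v).
    move=> /= abv; split => /=.
      by move: (abv ord0); rewrite (congr1 fst xv : rV_cons (x, v) ord0 ord0 = x).
    move=> i; move: (abv (lift ord0 i)).
    have := congr1 (fun q : _ * 'rV[R]_n => q.2 ord0 i) xv.
    by rewrite [X in X = _ -> _]mxE /a' /b' !mxE => ->.
  move=> [/= abx Bv] i.
  have xv := rV_consK (x, v).
  case: (unliftP ord0 i) => [j|] ->{i}.
    have := congr1 (fun q : _ * 'rV[R]_n => q.2 ord0 j) xv.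
    by rewrite [X in X = _ -> _]mxE => ->; move: (Bv j); rewrite /a' /b' !mxE.
  by rewrite (congr1 fst xv : rV_cons (x, v) ord0 ord0 = x).
rewrite product_measure1E//= IH; last by move=> i; rewrite !mxE.
rewrite lebesgue_measure_itv/= lte_fin big_ord_recl.
under eq_bigr do rewrite !mxE.
move: (ab ord0); rewrite le_eqVlt => /predU1P[->|abo].
  by rewrite ltxx subrr mul0e mul0r.
by rewrite abo EFinM.
Qed.

End lebesgue_rV.

Section vector_fields.
Context {R : realType} {n : nat}.
Implicit Types (A : set 'rV[R]_n) (f : 'rV[R]_n -> R).
Implicit Types (Y Z : 'rV[R]_n -> 'rV[R]_n).

Definition base_vec (k : 'I_n) : 'rV[R]_n := delta_mx ord0 k.

Definition partial f (k : 'I_n) : 'rV[R]_n -> R := 'D_(base_vec k) f.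

Fixpoint C_on (A : set 'rV[R]_n) (k : nat) (f : 'rV[R]_n -> R) : Prop :=
  (forall x, A x -> {for x, continuous f}) /\
  if k is k'.+1 then
    forall i, (forall x, A x -> derivable f x (base_vec i)) /\
              C_on A k' (partial f i)
  else True.

(* Meant for open A: the derivatives are then determined by f on A. *)
Definition smooth_on A f := forall k, C_on A k f.

Definition smooth_field A Y := forall k, smooth_on A (fun x => Y x ord0 k).

(* A field Y acts on functions by (Y f)(x) = 'D_(Y x) f x; the components of
   [Y, Z] are Y(Z_k) - Z(Y_k). *)
Definition lie_bracket Y Z : 'rV[R]_n -> 'rV[R]_n :=
  fun x => 'D_(Y x) Z x - 'D_(Z x) Y x.

Inductive commutator m (X : 'I_m -> 'rV[R]_n -> 'rV[R]_n) :
    nat -> ('rV[R]_n -> 'rV[R]_n) -> Prop :=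
| commutator_field j : commutator X 1 (X j)
| commutator_bracket k l Y Z :
    commutator X k Y -> commutator X l Z ->
    commutator X (k + l) (lie_bracket Y Z).

Definition hormander_condition m (X : 'I_m -> 'rV[R]_n -> 'rV[R]_n)
    (W : set 'rV[R]_n) :=
  exists r : nat, forall x, W x ->
    exists N (Y : 'I_N -> 'rV[R]_n -> 'rV[R]_n),
      (forall i, exists2 l, (l <= r)%N & commutator X l (Y i)) /\
      row_full (\matrix_(i < N) Y i x).

Definition formal_adjoint Y f : 'rV[R]_n -> R :=
  fun x => - \sum_(k < n) partial (fun y => Y y ord0 k * f y) k x.

Definition boundary A := closure A `\` A°.

(* A lies locally on one side of its boundary, the latter being the zero set
   of a smooth function with nonvanishing gradient. *)
Definition smooth_boundary A :=
  forall p, boundary A p ->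
    exists (U : set 'rV[R]_n) (rho : 'rV[R]_n -> R),
      [/\ open U, U p, smooth_on U rho,
          forall x, U x -> exists k, partial rho k x != 0 &
          A `&` U = [set x | U x /\ rho x < 0]].

Definition compactly_included A (W : set 'rV[R]_n) :=
  compact (closure A) /\ closure A `<=` W.

(* Classes of L^2(A) are represented by Borel functions; their values outside
   A do not matter. *)

Definition L2 A f :=
  measurable_fun A f /\
  (\int[lebesgue_rV n]_(x in A) (`|f x| ^+ 2)%:E < +oo)%E.

Definition L2norm A f : R :=
  Num.sqrt (\int[lebesgue_rV n]_(x in A) `|f x| ^+ 2).

(* C_0^infty(A), extended by 0 *)
Definition test_function A f :=
  [/\ smooth_on setT f, compact (closure [set x | f x != 0]) &
      closure [set x | f x != 0] `<=` A].

Definition weak_derivative (W : set 'rV[R]_n) Y (u v : 'rV[R]_n -> R) :=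
  forall phi, test_function W phi ->
    \int[lebesgue_rV n]_(x in W) (v x * phi x) =
    \int[lebesgue_rV n]_(x in W) (u x * formal_adjoint Y phi x).

(* A representative of the a.e. class of Y u in L^2(W), when there is one. *)
Definition along (W : set 'rV[R]_n) Y (u : 'rV[R]_n -> R) : 'rV[R]_n -> R :=
  get [set v | L2 W v /\ weak_derivative W Y u v].

Section sobolev.
Context {m : nat}.
Variables (X : 'I_m -> 'rV[R]_n -> 'rV[R]_n) (W : set 'rV[R]_n).
Implicit Types (u : 'rV[R]_n -> R) (Omega : set 'rV[R]_n).

Definition H1 u :=
  L2 W u /\ forall j, exists2 v, L2 W v & weak_derivative W (X j) u v.

(* |X u|^2 *)
Definition sqgrad u : 'rV[R]_n -> R :=
  fun x => \sum_(j < m) `|along W (X j) u x| ^+ 2.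

(* ||X u||^2 in L^2(A) *)
Definition energy A u : R := \int[lebesgue_rV n]_(x in A) sqgrad u x.

Definition H1norm u : R := Num.sqrt (L2norm W u ^+ 2 + energy W u).

Definition H10 Omega u :=
  H1 u /\ forall e : R, 0 < e ->
    exists2 phi, test_function Omega phi & H1norm (u \- phi) < e.

Definition lambda1 Omega : R :=
  inf [set energy Omega phi | phi in
        [set phi | H10 Omega phi /\ L2norm Omega phi = 1]].

End sobolev.
End vector_fields.

(* Main.v *)
(* No subelliptic estimate is needed.  Call a weight psi dominated when, for
   every e > 0, \int psi phi^2 <= e \int phi^2 + C_e \int |X phi|^2 for all test
   functions phi on Omega.  Integrating by parts, X_j^* f is dominated for every
   smooth f; since [Y, Z]^* = Z^* Y^* - Y^* Z^*, so is Y^* f for every iterated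
   commutator Y, hence, by Hormander's condition, the divergence of a suitable
   weight times any smooth field supported near a point.  Choosing a radial field
   whose divergence is positive except in a small ball shows that the set of points
   near which the indicator is dominated is closed in W.  It is open and contains
   the exterior of Omega, hence is W by connectedness; compactness of the closure
   of Omega makes the indicator of Omega dominated, which is the Poincare
   inequality for test functions.  It extends to H10 by density, weak derivatives
   being unique almost everywhere. *)
Require Import Defs.
From mathcomp Require Import all_boot all_order all_algebra.
From mathcomp Require Import all_classical all_reals all_analysis.
From mathcomp Require Import measurable_realfun ring lra.
Import Order.TTheory GRing.Theory Num.Theory.
Import numFieldNormedType.Exports.
Local Open Scope classical_set_scope.
Local Open Scope ring_scope.

Set Implicit Arguments.
Unset Strict Implicit.
Unset Printing Implicit Defensive.

(** * Smooth functions and partial derivatives *)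

(** The obstacle is that a commutator of length above 1 would put several derivatives on the test
    function [phi], while the energy controls only first ones. So all derivatives are placed on the
    weight instead. A single integration by parts against [phi ^+ 2] produces [phi * X_j phi], which
    splits into a small multiple of [phi ^+ 2] and a large multiple of the energy. Functions smooth
    on [W] are stable under formal adjoints, so the bracket identity can be iterated to any length.
    Every [e > 0] is kept in the definition because sums and multiples of weights inflate it; in the
    end the value 1/2 is absorbed. The bound is one-sided, so a dominated pointwise majorant
    suffices, and the negative part of a divergence costs only a multiple of the indicator of a
    small ball. The radius within which domination spreads depends on the target point alone, never
    on the source: this is what gives closedness. *)

Section smooth_calculus.
Context {R : realType} {n : nat}.
Implicit Types (A B : set 'rV[R]_n) (f g q : 'rV[R]_n -> R).

Lemma C_on0 A k f : C_on A k f -> forall x, A x -> {for x, continuous f}.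
Proof. by case: k => [|k] []. Qed.

Lemma C_on_subset A B k f : B `<=` A -> C_on A k f -> C_on B k f.
Proof.
move=> BA; elim: k f => [|k IH] f [fc fd]; split => //; first by move=> x /BA; exact: fc.
  by move=> x /BA; exact: fc.
by move=> i; have [fi Ci] := fd i; split => [x /BA|]; [exact: fi|exact: IH].
Qed.

Lemma C_onW A k f : C_on A k.+1 f -> C_on A k f.
Proof.
elim: k f => [|k IH] f [fc fd]; split => //.
by move=> i; have [fi Ci] := fd i; split => //; exact: IH.
Qed.

Lemma near_open A x : open A -> A x -> \forall y \near x, A y.
Proof. by move=> oA Ax; apply: open_nbhs_nbhs. Qed.

Lemma eq_partial A f g i : open A -> {in A, f =1 g} ->
  forall x, A x -> partial f i x = partial g i x.
Proof.
move=> oA fg x Ax; apply: near_eq_derive; apply: filterS (near_open oA Ax) => y Ay.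
by apply: fg; rewrite inE.
Qed.

Lemma eq_derivable A f g (v x : 'rV[R]_n) : open A -> {in A, f =1 g} -> A x ->
  derivable f x v -> derivable g x v.
Proof.
move=> oA fg Ax; apply: near_eq_derivable; apply: filterS (near_open oA Ax) => y Ay.
by apply: fg; rewrite inE.
Qed.

Lemma eq_continuous_at A f g (x : 'rV[R]_n) : open A -> {in A, f =1 g} -> A x ->
  {for x, continuous f} -> {for x, continuous g}.
Proof.
move=> oA fg Ax fx; have fgx := fg x (mem_set Ax); change (g @ x --> g x).
rewrite -fgx; apply: cvg_trans fx; apply: (@near_eq_cvg _ _ (nbhs x)).
by apply: filterS (near_open oA Ax) => y Ay; rewrite fg// inE.
Qed.

Lemma eq_C_on A k f g : open A -> {in A, f =1 g} -> C_on A k f -> C_on A k g.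
Proof.
move=> oA; elim: k f g => [|k IH] f g fg [fc fd]; split => //.
- by move=> x Ax; exact: eq_continuous_at fg Ax (fc x Ax).
- by move=> x Ax; exact: eq_continuous_at fg Ax (fc x Ax).
- move=> i; have [fi Ci] := fd i; split.
    by move=> x Ax; apply: (eq_derivable oA fg Ax); exact: fi.
  apply: IH Ci => x; rewrite inE => Ax; exact: eq_partial Ax.
Qed.

Lemma partial_cst a i (x : 'rV[R]_n) : partial (cst a) i x = 0.
Proof. exact: derive_cst. Qed.

Lemma C_on_cst A k a : C_on A k (cst a).
Proof.
elim: k a => [|k IH] a; split => //; try by move=> x _; exact: cst_continuous.
move=> i; split; first by move=> x _; have [] := is_derive_cst a x (base_vec i : 'rV[R]_n).
rewrite (_ : partial _ _ = cst 0); first exact: IH.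
by apply/funext => x; exact: partial_cst.
Qed.

Lemma C_onD A k f g : open A -> C_on A k f -> C_on A k g -> C_on A k (f \+ g).
Proof.
move=> oA; elim: k f g => [|k IH] f g [fc fd] [gc gd]; split => //.
- by move=> x Ax; apply: continuousD; [exact: fc|exact: gc].
- by move=> x Ax; apply: continuousD; [exact: fc|exact: gc].
move=> i; have [fi Cf] := fd i; have [gi Cg] := gd i; split.
  by move=> x Ax; apply: derivableD; [exact: fi|exact: gi].
apply: (@eq_C_on _ _ (partial f i \+ partial g i)) => //; last exact: IH.
move=> x; rewrite inE => Ax; rewrite /= /partial [RHS]deriveD//; [exact: fi|exact: gi].
Qed.

Lemma C_onM A k f g : open A -> C_on A k f -> C_on A k g -> C_on A k (f \* g).
Proof.
move=> oA; elim: k f g => [|k IH] f g Cf Cg; split => //.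
- by move=> x Ax; apply: continuousM; [exact: C_on0 Cf _ Ax|exact: C_on0 Cg _ Ax].
- by move=> x Ax; apply: continuousM; [exact: C_on0 Cf _ Ax|exact: C_on0 Cg _ Ax].
move=> i; have [fi C'f] := Cf.2 i; have [gi C'g] := Cg.2 i; split.
  by move=> x Ax; apply: derivableM; [exact: fi|exact: gi].
apply: (@eq_C_on _ _ ((f \* partial g i) \+ (g \* partial f i))) => //; last first.
  by apply: C_onD => //; apply: IH => //; exact: C_onW.
move=> x; rewrite inE => Ax; rewrite /= /partial [RHS]deriveM//; [exact: fi|exact: gi].
Qed.

Lemma smooth_on_subset A B f : B `<=` A -> smooth_on A f -> smooth_on B f.
Proof. by move=> BA sf k; apply: C_on_subset (sf k). Qed.

Lemma eq_smooth_on A f g : open A -> {in A, f =1 g} ->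
  smooth_on A f -> smooth_on A g.
Proof. by move=> oA fg sf k; apply: eq_C_on (sf k). Qed.

Lemma smooth_on_continuous A f x : smooth_on A f -> A x -> {for x, continuous f}.
Proof. by move=> sf Ax; exact: C_on0 (sf 0%N) x Ax. Qed.

Lemma smooth_on_derivable A f x i : smooth_on A f -> A x ->
  derivable f x (base_vec i).
Proof. by move=> sf Ax; have [_ /(_ i)[+ _]] := sf 1%N; exact. Qed.

Lemma smooth_on_partial A f i : smooth_on A f -> smooth_on A (partial f i).
Proof. by move=> sf k; have [_ /(_ i)[]] := sf k.+1. Qed.

Lemma smooth_on_cst A a : smooth_on A (cst a).
Proof. by move=> k; exact: C_on_cst. Qed.

Lemma smooth_onD A f g : open A -> smooth_on A f -> smooth_on A g ->
  smooth_on A (fun x => f x + g x).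
Proof. by move=> oA sf sg k; exact: (C_onD oA (sf k) (sg k)). Qed.

Lemma smooth_onM A f g : open A -> smooth_on A f -> smooth_on A g ->
  smooth_on A (fun x => f x * g x).
Proof. by move=> oA sf sg k; exact: (C_onM oA (sf k) (sg k)). Qed.

Lemma smooth_onZ A a f : open A -> smooth_on A f ->
  smooth_on A (fun x => a * f x).
Proof. by move=> oA sf; apply: smooth_onM => //; exact: smooth_on_cst. Qed.

Lemma smooth_onN A f : open A -> smooth_on A f -> smooth_on A (fun x => - f x).
Proof.
move=> oA sf; rewrite (_ : (fun x => - f x) = fun x => -1 * f x); last first.
  by apply/funext => x; rewrite mulN1r.
exact: smooth_onZ.
Qed.

Lemma smooth_onB A f g : open A -> smooth_on A f -> smooth_on A g ->
  smooth_on A (fun x => f x - g x).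
Proof. by move=> oA sf sg; apply: smooth_onD => //; exact: smooth_onN. Qed.

Lemma smooth_on_sum A I (s : seq I) (P : pred I) (F : I -> 'rV[R]_n -> R) :
  open A -> (forall i, P i -> smooth_on A (F i)) ->
  smooth_on A (fun x => \sum_(i <- s | P i) F i x).
Proof.
move=> oA sF; elim: s => [|i s IH].
  by under eq_fun do rewrite big_nil; exact: smooth_on_cst.
under eq_fun do rewrite big_cons.
by case Pi : (P i) => //; apply: smooth_onD => //; exact: sF.
Qed.

Lemma smooth_on_prod A I (s : seq I) (P : pred I) (F : I -> 'rV[R]_n -> R) :
  open A -> (forall i, P i -> smooth_on A (F i)) ->
  smooth_on A (fun x => \prod_(i <- s | P i) F i x).
Proof.
move=> oA sF; elim: s => [|i s IH].
  by under eq_fun do rewrite big_nil; exact: smooth_on_cst.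
under eq_fun do rewrite big_cons.
by case Pi : (P i) => //; apply: smooth_onM => //; exact: sF.
Qed.

Lemma smooth_on_det A k (M : 'rV[R]_n -> 'M[R]_k) : open A ->
  (forall i j, smooth_on A (fun x => M x i j)) -> smooth_on A (fun x => \det (M x)).
Proof.
move=> oA sM; rewrite /determinant; apply: smooth_on_sum => // s _.
by apply: smooth_onZ => //; apply: smooth_on_prod.
Qed.

Lemma smooth_on_adj A k (M : 'rV[R]_n -> 'M[R]_k) i j : open A ->
  (forall i j, smooth_on A (fun x => M x i j)) ->
  smooth_on A (fun x => (\adj (M x)) i j).
Proof.
move=> oA sM; under eq_fun do rewrite mxE /cofactor.
apply: smooth_onZ => //; apply: smooth_on_det => // a b.
by under eq_fun do rewrite !mxE; exact: sM.
Qed.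

Lemma is_derive_coord (j : 'I_n) (x v : 'rV[R]_n) :
  is_derive x v (fun y : 'rV[R]_n => y ord0 j) (v ord0 j).
Proof.
apply: DeriveDef; first exact/diff_derivable/differentiable_coord.
have /(congr1 (fun w : 'rV[R]_n => w ord0 j)) := derive_mx (@derivable_id _ _ x v).
by rewrite derive_id mxE => <-.
Qed.

Lemma partial_coord (j i : 'I_n) (x : 'rV[R]_n) :
  partial (fun y : 'rV[R]_n => y ord0 j) i x = (i == j)%:R.
Proof.
rewrite /partial (@derive_val _ _ _ _ _ _ _ (is_derive_coord j x (base_vec i))).
by rewrite /base_vec mxE eqxx eq_sym.
Qed.

Lemma smooth_on_coord A (j : 'I_n) : smooth_on A (fun y => y ord0 j).
Proof.
case=> [|k]; first by split => // x _; exact: coord_continuous.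
split; first by move=> x _; exact: coord_continuous.
move=> i; split; first by move=> x _; have [] := is_derive_coord j x (base_vec i).
rewrite (_ : partial _ _ = cst (i == j)%:R); first exact: C_on_cst.
by apply/funext => x; exact: partial_coord.
Qed.

Lemma partialD A f g i x : smooth_on A f -> smooth_on A g -> A x ->
  partial (fun y => f y + g y) i x = partial f i x + partial g i x.
Proof.
by move=> sf sg Ax; rewrite /partial deriveD//; exact: smooth_on_derivable Ax.
Qed.

Lemma partialM A f g i x : smooth_on A f -> smooth_on A g -> A x ->
  partial (fun y => f y * g y) i x = partial f i x * g x + f x * partial g i x.
Proof.
move=> sf sg Ax; rewrite /partial deriveM//; [|exact: smooth_on_derivable Ax..].
by rewrite addrC; congr (_ + _); rewrite /GRing.scale/= mulrC.
Qed.

Lemma partialZ A a f i x : smooth_on A f -> A x ->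
  partial (fun y => a * f y) i x = a * partial f i x.
Proof.
move=> sf Ax; rewrite (partialM i (smooth_on_cst A a) sf)//.
by rewrite partial_cst mul0r add0r.
Qed.

Lemma partialN A f i x : smooth_on A f -> A x ->
  partial (fun y => - f y) i x = - partial f i x.
Proof. by move=> sf Ax; rewrite /partial deriveN//; exact: smooth_on_derivable Ax. Qed.

Lemma partialB A f g i x : smooth_on A f -> smooth_on A g -> A x ->
  partial (fun y => f y - g y) i x = partial f i x - partial g i x.
Proof.
by move=> sf sg Ax; rewrite /partial deriveB//; exact: smooth_on_derivable Ax.
Qed.

Lemma partial_sum A I (s : seq I) (P : pred I) (F : I -> 'rV[R]_n -> R) i x :
  open A -> (forall j, P j -> smooth_on A (F j)) -> A x ->
  partial (fun y => \sum_(j <- s | P j) F j y) i x =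
  \sum_(j <- s | P j) partial (F j) i x.
Proof.
move=> oA sF Ax; elim: s => [|j s IH].
  by under [in LHS]eq_fun do rewrite big_nil; rewrite big_nil; exact: partial_cst.
under [in LHS]eq_fun do rewrite big_cons.
rewrite big_cons; case: ifP => // Pj; rewrite -IH (@partialD A)//; first exact: sF.
exact: smooth_on_sum.
Qed.

End smooth_calculus.

(** * Directional derivatives and the mean value theorem along lines *)

Section directional_derivatives.
Context {R : realType} {V : normedModType R}.
Implicit Types (f : V -> R) (x v w : V).

Lemma is_derive_line f x v (s : R) : derivable f (s *: v + x) v ->
  is_derive s (1 : R) (fun t : R => f (t *: v + x)) ('D_v f (s *: v + x)).
Proof.
have E : (fun h : R => h^-1 *: (((fun t : R => f (t *: v + x)) \o shift s) (h *: (1 : R))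
      - f (s *: v + x))) =
    (fun h => h^-1 *: ((f \o shift (s *: v + x)) (h *: v) - f (s *: v + x))).
  apply/funext => h /=; congr (_ *: (f _ - _)).
  by rewrite scalerDl addrA [_ *: 1]mulr1.
by move=> fv; apply: DeriveDef; rewrite /derivable /derive E.
Qed.

(** Brings the one-variable chain rule to functions on [V]; used for the composites
    [flat k (q y)]. *)
Lemma is_derive_of_line f x v (d : R) :
  is_derive (0 : R) (1 : R) (fun t : R => f (t *: v + x)) d -> is_derive x v f d.
Proof.
move=> [fd dE]; have fv : derivable f x v by exact/derivable1P.
apply: DeriveDef => //; rewrite -dE.
by have := @is_derive_line f x v 0; rewrite scale0r add0r => /(_ fv) [_ ->].
Qed.

Lemma is_derive_trans f x v w (d : R) : is_derive (x + w) v f d ->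
  is_derive x v (fun y => f (y + w)) d.
Proof.
have E : (fun h : R => h^-1 *: (((fun y => f (y + w)) \o shift x) (h *: v)
      - f (x + w))) =
    (fun h => h^-1 *: ((f \o shift (x + w)) (h *: v) - f (x + w))).
  by apply/funext => h /=; congr (_ *: (f _ - _)); rewrite addrA.
by move=> [fv <-]; apply: DeriveDef; rewrite /derivable /derive E.
Qed.

Lemma MVT_line f x v (s : R) :
  (forall t : R, `|t| <= `|s| -> derivable f (t *: v + x) v) ->
  exists2 t : R, `|t| <= `|s| &
    f (s *: v + x) - f x = s * 'D_v f (t *: v + x).
Proof.
move=> fv; pose g (t : R) := f (t *: v + x); pose dg (t : R) := 'D_v f (t *: v + x).
have gd (t : R) : `|t| <= `|s| -> is_derive t 1 g (dg t).
  by move=> ts; apply: is_derive_line; exact: fv.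
have g0 : g 0 = f x by rewrite /g scale0r add0r.
have gc a b : (forall t, t \in `[a, b]%R -> `|t| <= `|s|) ->
    {within `[a, b], continuous g}.
  by move=> ab; apply: derivable_within_continuous => t /ab /gd [].
have [s0|s0] := lerP 0 s.
- have abs t : t \in `[0, s]%R -> `|t| <= `|s|.
    by rewrite in_itv/= => /andP[t0 ts]; rewrite !ger0_norm.
  have [||t ts] := @MVT_segment R g dg 0 s s0; [|exact: gc|].
    by move=> t ts; apply/gd/abs; exact: subset_itv_oo_cc.
  by rewrite g0 subr0 mulrC => fE; exists t => //; exact: abs.
- have abs t : t \in `[s, 0]%R -> `|t| <= `|s|.
    by rewrite in_itv/= => /andP[ts t0]; rewrite !ler0_norm ?lerN2// ltW.
  have [||t ts] := @MVT_segment R g dg s 0 (ltW s0); [|exact: gc|].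
    by move=> t ts; apply/gd/abs; exact: subset_itv_oo_cc.
  rewrite g0 sub0r mulrN mulrC => fE; exists t; first exact: abs.
  by rewrite -[RHS]opprK -fE opprB.
Qed.

(** The increment along [h *: (p + c *: v)] is an increment along [h *: p] followed by one along
    [v]. The second equals [h * c] times a value of ['D_v f] at a nearby point, by the mean value
    theorem, so continuity of ['D_v f] at [x] alone gives the limit. *)
Lemma is_derive_add_dir f x p v (c d : R) : is_derive x p f d ->
  (\forall y \near x, derivable f y v) -> {for x, continuous ('D_v f)} ->
  is_derive x (p + c *: v) f (d + c * 'D_v f x).
Proof.
move=> [fp fpE] nfv cfv; suff cv :
    h^-1 *: ((f \o shift x) (h *: (p + c *: v)) - f x) @[h --> 0^'] -->
    d + c * 'D_v f x.
  apply: DeriveDef; first by apply/cvg_ex; exists (d + c * 'D_v f x).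
  exact: cvg_lim cv.
have cp : h^-1 *: ((f \o shift x) (h *: p) - f x) @[h --> 0^'] --> d.
  by rewrite -fpE; exact: fp.
apply/cvgrPdist_le => /= e e0.
have c1 : 0 < `|c| + 1 by rewrite ltr_wpDl.
have /cvgrPdist_le/(_ (e / 2 / (`|c| + 1)))/= := cfv.
rewrite !divr_gt0// => /(_ isT) ncfv.
have [/= r r0 rP] := (nbhs_ballP _ _).1 (filterI nfv ncfv).
move/cvgrPdist_le : cp => /(_ (e / 2)) /[!divr_gt0]// /(_ isT) cp.
(* [M * |h|] bounds every displacement [h *: p + t *: v] with [|t| <= |h * c|]; the 1 keeps [M]
   positive. *)
pose M := `|p| + `|c| * `|v| + 1.
have M0 : 0 < M by rewrite ltr_wpDl// addr_ge0// mulr_ge0.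
near=> h.
have h0 : h != 0 by near: h; exact: nbhs_dnbhs_neq.
have hr : `|h| < r / M by near: h; apply: dnbhs0_lt; rewrite divr_gt0.
have inball t : `|t| <= `|h * c| -> ball x r (t *: v + (h *: p + x)).
  move=> thc; rewrite -ball_normE /ball_/= addrA opprD addrCA subrr addr0 normrN.
  rewrite ltr_pdivlMr// in hr; apply: le_lt_trans hr.
  rewrite (le_trans (ler_normD _ _))// !normrZ.
  apply: (@le_trans _ _ (`|h| * `|c| * `|v| + `|h| * `|p|)).
    by rewrite lerD2r ler_wpM2r// -normrM.
  by rewrite /M !mulrDr mulr1 -!mulrA addrC lerDl.
have [t th fE] := @MVT_line f (h *: p + x) v (h * c)
  (fun t th => (rP _ (inball t th)).1).
have -> : (f \o shift x) (h *: (p + c *: v)) - f x =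
    (f (h *: p + x) - f x) + h * c * 'D_v f (t *: v + (h *: p + x)).
  rewrite /= -fE -scalerA scalerDr [RHS]addrC subrKA.
  by congr (f _ - _); rewrite addrAC addrC.
rewrite scalerDr opprD addrACA (le_trans (ler_normD _ _))// (splitr e) lerD//.
  by near: h.
rewrite /GRing.scale/= !mulrA mulVf// mul1r -mulrBr normrM.
have := (rP _ (inball t th)).2; rewrite ler_pdivlMr//; apply: le_trans.
by rewrite mulrC ler_wpM2l// lerDl.
Unshelve. all: by end_near. Qed.

End directional_derivatives.

(** * From partial to directional derivatives; symmetry of second derivatives *)

Section partial_derivatives.
Context {R : realType} {n : nat}.
Implicit Types (A : set 'rV[R]_n) (f g q : 'rV[R]_n -> R).

(** [smooth_on] speaks of coordinate directions only, whereas [lie_bracket] differentiates along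
    arbitrary vectors. The bridge adds the coordinates of [v] one at a time by
    [is_derive_add_dir]. *)
Lemma is_derive_partials A f (x v : 'rV[R]_n) : open A -> smooth_on A f -> A x ->
  is_derive x v f (\sum_k v ord0 k * partial f k x).
Proof.
move=> oA sf Ax; rewrite {1}(row_sum_delta v).
elim: (index_enum 'I_n) => [|k s IH].
  by rewrite !big_nil; exact: is_derive0.
rewrite !big_cons addrC [X in is_derive _ _ _ X]addrC.
apply: is_derive_add_dir => //.
  by apply: filterS (near_open oA Ax) => y; exact: smooth_on_derivable.
by apply: smooth_on_continuous Ax; exact: smooth_on_partial.
Qed.

(** Schwarz's argument: the second difference with the same step [s] in both directions is symmetric
    in [i] and [j], and divided by [s ^+ 2] it is within any [e] of either mixed derivative for
    small [s]. *)
Lemma partial_comm A f i j (x : 'rV[R]_n) : open A -> smooth_on A f -> A x ->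
  partial (partial f i) j x = partial (partial f j) i x.
Proof.
move=> oA sf Ax.
suff P (i' j' : 'I_n) (e : R) : 0 < e -> \forall s \near 0^', exists2 d : R,
      `|d - partial (partial f i') j' x| <= e &
      f (s *: base_vec i' + (s *: base_vec j' + x)) - f (s *: base_vec i' + x)
      - f (s *: base_vec j' + x) + f x = s * (s * d).
  apply/eqP; rewrite -subr_eq0 -normr_le0; apply/ler_addgt0Pr => e e0.
  rewrite add0r.
  have e20 : 0 < e / 2 by rewrite divr_gt0.
  near (0 : R)^' => s; have s0 : s != 0 by near: s; exact: nbhs_dnbhs_neq.
  have [c ce cE] : exists2 d : R, `|d - partial (partial f i) j x| <= e / 2 &
      f (s *: base_vec i + (s *: base_vec j + x)) - f (s *: base_vec i + x)
      - f (s *: base_vec j + x) + f x = s * (s * d) by near: s; exact: P.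
  have [d de dE] : exists2 d : R, `|d - partial (partial f j) i x| <= e / 2 &
      f (s *: base_vec j + (s *: base_vec i + x)) - f (s *: base_vec j + x)
      - f (s *: base_vec i + x) + f x = s * (s * d) by near: s; exact: P.
  have cd : c = d.
    apply: (mulfI s0); apply: (mulfI s0); rewrite -cE -dE.
    by rewrite (addrCA (s *: base_vec i)); congr (_ + _); rewrite addrAC.
  move: ce de; rewrite -cd; clear.
  move: (partial (partial f i) j x) (partial (partial f j) i x) => a b ca cb.
  by rewrite -(subrKA c) (splitr e) (le_trans (ler_normD _ _))// lerD// distrC.
move=> e0; have sp := smooth_on_partial i' sf.
have /cvgrPdist_le/(_ e e0) := smooth_on_continuous (smooth_on_partial j' sp) Ax.
move=> /(filterI (near_open oA Ax)) /nbhs_ballP[/= r r0 rP].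
pose M := `|base_vec i' : 'rV[R]_n| + `|base_vec j' : 'rV[R]_n| + 1.
have M0 : 0 < M by rewrite ltr_wpDl// addr_ge0.
near=> s.
have sr : `|s| < r / M by near: s; apply: dnbhs0_lt; rewrite divr_gt0.
have inball a b : `|a| <= `|s| -> `|b| <= `|s| ->
    ball x r (a *: base_vec i' + (b *: base_vec j' + x)).
  move=> sa sb; rewrite -ball_normE /ball_/= addrA opprD addrCA subrr addr0 normrN.
  rewrite ltr_pdivlMr// in sr; apply: le_lt_trans sr.
  rewrite (le_trans (ler_normD _ _))// !normrZ /M !mulrDr.
  by rewrite -[leLHS]addr0 lerD ?mulr_ge0 ?lerD// ler_wpM2r.
have inball2 b a : `|b| <= `|s| -> `|a| <= `|s| ->
    A (b *: base_vec j' + (a *: base_vec i' + x)).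
  by move=> bs /inball/(_ bs)/rP[+ _]; rewrite addrCA.
(* The mean value theorem is applied to this increment along [i'], then to [partial f i'] along
   [j']; the second difference becomes [s * s] times the mixed derivative at a nearby point. *)
pose g y := f (y + s *: base_vec j') - f y.
have gd a : `|a| <= `|s| -> is_derive (a *: base_vec i' + x) (base_vec i') g
    (partial f i' (s *: base_vec j' + (a *: base_vec i' + x))
     - partial f i' (a *: base_vec i' + x)).
  move=> sa; apply: is_deriveB; last first.
    apply/derivableP/smooth_on_derivable; first exact: sf.
    by have := @inball2 0 a; rewrite scale0r add0r normr0; apply.
  apply: is_derive_trans; rewrite addrC.
  by apply/derivableP/smooth_on_derivable; [exact: sf|exact: inball2].
have [|a sa gE] := @MVT_line _ _ g x (base_vec i') s.
  by move=> a /gd [].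
have [|b sb hE] := @MVT_line _ _ (partial f i') (a *: base_vec i' + x) (base_vec j') s.
  move=> b sb; apply: (smooth_on_derivable (A := A)) => //.
  exact: inball2.
exists (partial (partial f i') j' (b *: base_vec j' + (a *: base_vec i' + x))).
  by rewrite distrC addrCA; have [] := rP _ (inball a b sa sb).
rewrite -hE; have [_ <-] := gd a sa; rewrite -gE /g.
rewrite -(addrA _ x) (addrC x) -/(base_vec _).
by move: (f _) (f _) (f _) (f _) => p q r' t'; ring.
Unshelve. all: by end_near. Qed.

End partial_derivatives.

(** * The flat functions and the smoothness of their composites *)

Section flat_bump.
Context {R : realType}.

(** The classical flat function is the case [k = 0]. The powers of [t^-1] make the family closed
    under differentiation up to linear combinations, so smoothness follows by induction on the
    order, for all [k] at once. The relation [flat 2 t = flat 0 t / t ^+ 2] for [0 < t] later makes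
    a divergence large. *)
Definition flat (k : nat) (t : R) : R :=
  if 0 < t then t^-1 ^+ k * expR (- t^-1) else 0.

Lemma flat_ge0 k t : 0 <= flat k t.
Proof.
by rewrite /flat; case: ifPn => // t0; rewrite mulr_ge0 ?expR_ge0 ?exprn_ge0 ?invr_ge0 ?ltW.
Qed.

Lemma flat_gt0 k t : 0 < t -> 0 < flat k t.
Proof. by move=> t0; rewrite /flat t0 mulr_gt0 ?expR_gt0// exprn_gt0// invr_gt0. Qed.

Lemma flat_eq0 k t : t <= 0 -> flat k t = 0.
Proof. by rewrite /flat; case: ltrP. Qed.

Lemma flat0_le1 t : flat 0 t <= 1.
Proof.
rewrite /flat; case: ifPn => // t0; rewrite expr0 mul1r expR_le1.
by rewrite oppr_le0 invr_ge0 ltW.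
Qed.

Lemma flatS k t : flat k.+1 t = t^-1 * flat k t.
Proof. by rewrite /flat; case: ifPn => t0; rewrite ?mulr0// exprS mulrA. Qed.

(** For [0 < t] this is [u ^+ k.+1 / (k.+1)! <= expR u] at [u = t^-1]. Any bound vanishing at 0
    would serve. *)
Lemma flat_bound k t : `|flat k t| <= (k.+1)`!%:R * `|t|.
Proof.
rewrite ger0_norm ?flat_ge0//; have [t0|t0] := lerP t 0.
  by rewrite flat_eq0// mulr_ge0.
rewrite /flat t0 gtr0_norm// expRN ler_pdivrMr ?expR_gt0//.
have u0 : 0 <= t^-1 by rewrite invr_ge0 ltW.
have := expR_ge1Dxn k u0.
have fk : 0 < (k.+1)`!%:R :> R by rewrite ltr0n fact_gt0.
move=> H; have {H} : t^-1 ^+ k.+1 / (k.+1)`!%:R <= expR t^-1.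
  by apply: le_trans H; rewrite lerDr.
rewrite ler_pdivrMr// => H.
rewrite exprS in H.
have {1}-> : t^-1 ^+ k = t * (t^-1 * t^-1 ^+ k).
  by rewrite mulrA divff ?mul1r// gt_eqF.
by rewrite -[leRHS]mulrA [leRHS]mulrCA ler_pM2l// [leRHS]mulrC.
Qed.

Lemma is_derive_flat k (t : R) :
  is_derive t 1 (flat k) (flat k.+2 t - k%:R * flat k.+1 t).
Proof.
have [t0|t0|->] := ltrgt0P t.
- have inv_d : is_derive t 1 (fun s : R => s^-1) (- (t^-1 ^+ 2)).
    apply: DeriveDef; first by apply: derivableV; rewrite ?gt_eqF.
    by rewrite (@deriveV _ _ id) ?gt_eqF// derive_id [_ *: _]mulr1 exprVn.
  have exp_d : is_derive t 1 (fun s => expR (- s^-1)) (expR (- t^-1) * t^-1 ^+ 2).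
    have inv_dN := @is_deriveN _ _ _ (fun s : R => s^-1) t 1 _ inv_d.
    have := @is_derive1_comp _ expR (fun s => - s^-1) t _ _ (is_derive_expR _) inv_dN.
    by rewrite opprK.
  have pow_d := @is_deriveX _ _ _ k t 1 _ inv_d.
  apply: (@near_eq_is_derive _ _ _ ((fun s : R => s^-1) ^+ k \* (fun s => expR (- s^-1)))).
    near=> s; have s0 : 0 < s by near: s; exact: lt_nbhsr.
    by rewrite /flat s0 /= exprfctE.
  apply: is_derive_eq; rewrite /flat t0 exprfctE /GRing.scale/=.
  by case: k {pow_d} => [|k]; rewrite ?exprS/=; ring.
- apply: (@near_eq_is_derive _ _ _ (cst 0)).
    near=> s; have s0 : s < 0 by near: s; exact: lt_nbhsl.
    by rewrite flat_eq0// ltW.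
  by rewrite !flat_eq0 ?mulr0 ?subr0 ?ltW//; exact: is_derive_cst.
(* At 0 the difference quotient with step [h] is [flat k.+1 h], which [flat_bound] makes of order
   [h]. *)
- rewrite !flat_eq0// mulr0 subr0.
  suff c0 : h^-1 *: ((flat k \o shift 0) (h *: (1 : R)) - flat k 0) @[h --> 0^'] --> (0 : R).
    by apply: DeriveDef; [apply/cvg_ex; exists 0|exact: cvg_lim c0].
  apply/cvgrPdist_le => /= e e0; near=> h.
  rewrite sub0r normrN addr0 [_ *: 1]mulr1 (flat_eq0 _ (lexx 0)) subr0 /GRing.scale/= -flatS.
  rewrite (le_trans (flat_bound _ _))// -ler_pdivlMl ?ltr0n ?fact_gt0//.
  by near: h; apply: dnbhs0_le; rewrite mulr_gt0 ?invr_gt0 ?ltr0n ?fact_gt0.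
Unshelve. all: by end_near. Qed.

Lemma flat_continuous k : continuous (flat k).
Proof.
by move=> t; apply/differentiable_continuous/derivable1_diffP; have [] := is_derive_flat k t.
Qed.

Lemma is_derive_flat_comp n k (q : 'rV[R]_n -> R) x v (d : R) : is_derive x v q d ->
  is_derive x v (fun y => flat k (q y)) ((flat k.+2 (q x) - k%:R * flat k.+1 (q x)) * d).
Proof.
move=> [qx <-]; apply: is_derive_of_line.
apply: (@is_derive1_comp _ (flat k) (fun t : R => q (t *: v + x))).
  by rewrite scale0r add0r; exact: is_derive_flat.
have := @is_derive_line _ _ q x v 0; rewrite scale0r add0r; exact.
Qed.

Lemma smooth_on_flat n (A : set 'rV[R]_n) k q : open A -> smooth_on A q ->
  smooth_on A (fun x => flat k (q x)).
Proof.
move=> oA sq K; elim: K k => [|K IH] k.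
  by split => // x Ax; apply: continuous_comp; [exact: smooth_on_continuous Ax|exact: flat_continuous].
split.
  by move=> x Ax; apply: continuous_comp; [exact: smooth_on_continuous Ax|exact: flat_continuous].
move=> i.
have D x : A x -> is_derive x (base_vec i) (fun y => flat k (q y))
    ((flat k.+2 (q x) - k%:R * flat k.+1 (q x)) * partial q i x).
  by move=> Ax; apply/is_derive_flat_comp/derivableP; exact: smooth_on_derivable Ax.
split; first by move=> x /D [].
apply: (@eq_C_on _ _ _ _ ((fun x => (flat k.+2 (q x) - k%:R * flat k.+1 (q x))) \* partial q i)) => //.
  by move=> x; rewrite inE => /D [_]; rewrite /partial => ->.
apply: C_onM => //; last exact: smooth_on_partial.
rewrite (_ : (fun x => _ - _) = (fun x => flat k.+2 (q x)) \+
  (cst (- k%:R) \* (fun x => flat k.+1 (q x)))); last first.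
  by apply/funext => x /=; rewrite mulNr.
by apply: C_onD => //; apply: C_onM => //; exact: C_on_cst.
Qed.

End flat_bump.

(** * Formal adjoints of commutators *)

Section commutators.
Context {R : realType} {n : nat}.
Variables (W : set 'rV[R]_n) (oW : open W).
Implicit Types (f g : 'rV[R]_n -> R) (Y Z : 'rV[R]_n -> 'rV[R]_n).

Lemma smooth_formal_adjoint Y f : smooth_field W Y -> smooth_on W f ->
  smooth_on W (formal_adjoint Y f).
Proof.
move=> sY sf; apply: smooth_onN => //; apply: smooth_on_sum => // k _.
by apply: smooth_on_partial; apply: smooth_onM => //; exact: sY.
Qed.

Lemma derive_fieldE Y Z x k : smooth_field W Z -> W x ->
  ('D_(Y x) Z x) ord0 k = \sum_a Y x ord0 a * partial (fun y => Z y ord0 k) a x.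
Proof.
move=> sZ Wx; rewrite derive_mx; last first.
  apply/derivable_mxP => i j; rewrite ord1.
  by have [] := is_derive_partials (Y x) oW (sZ j) Wx.
by rewrite mxE; have [_ ->] := is_derive_partials (Y x) oW (sZ k) Wx.
Qed.

Lemma lie_bracketE Y Z x k : smooth_field W Y -> smooth_field W Z -> W x ->
  lie_bracket Y Z x ord0 k =
  \sum_a (Y x ord0 a * partial (fun y => Z y ord0 k) a x
          - Z x ord0 a * partial (fun y => Y y ord0 k) a x).
Proof.
by move=> sY sZ Wx; rewrite /lie_bracket !mxE !derive_fieldE// sumrB.
Qed.

Lemma smooth_lie_bracket Y Z : smooth_field W Y -> smooth_field W Z ->
  smooth_field W (lie_bracket Y Z).
Proof.
move=> sY sZ k.
apply: (@eq_smooth_on _ _ _ (fun x =>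
  \sum_a (Y x ord0 a * partial (fun y => Z y ord0 k) a x
          - Z x ord0 a * partial (fun y => Y y ord0 k) a x))) => //.
  by move=> x; rewrite inE => Wx; rewrite lie_bracketE.
apply: smooth_on_sum => // a _; apply: smooth_onB => //; apply: smooth_onM => //.
- exact/smooth_on_partial/sZ.
- exact/smooth_on_partial/sY.
Qed.

(** Written so that the second-order part is symmetric: exchanging [Y] with [Z] and [a] with [b]
    leaves the first summand unchanged, so it cancels in the commutator of the two adjoints, as
    [sum2B_exchange] records. *)
Lemma formal_adjoint_comp Y Z f x : smooth_field W Y -> smooth_field W Z ->
  smooth_on W f -> W x ->
  formal_adjoint Z (formal_adjoint Y f) x =
  \sum_a \sum_b (partial (partial (fun y => Z y ord0 a * (Y y ord0 b * f y)) b) a x -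
    partial (fun y => Y y ord0 b * f y * partial (fun w => Z w ord0 a) b y) a x).
Proof.
move=> sY sZ sf Wx; rewrite /formal_adjoint -sumrN; apply: eq_bigr => a _.
have sYf b : smooth_on W (fun y => Y y ord0 b * f y) by apply: smooth_onM; last exact: sf.
have sZYf b : smooth_on W (fun y => Z y ord0 a * (Y y ord0 b * f y)).
  by apply: smooth_onM => //; exact: sZ.
have sR b : smooth_on W (fun y => Y y ord0 b * f y * partial (fun w => Z w ord0 a) b y).
  by apply: smooth_onM => //; exact/smooth_on_partial/sZ.
transitivity (partial (fun y => \sum_b (partial (fun y => Z y ord0 a * (Y y ord0 b * f y)) b y -
    Y y ord0 b * f y * partial (fun w => Z w ord0 a) b y)) a x).
  rewrite -(@partialN _ _ W)//; last first.
    apply: smooth_onM => //; apply: smooth_onN => //.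
    by apply: smooth_on_sum => // b _; exact: smooth_on_partial.
  apply: (@eq_partial _ _ W _ _ a oW _ x Wx) => y; rewrite inE => Wy.
  rewrite mulrN opprK mulr_sumr; apply: eq_bigr => b _.
  by have /= -> := partialM b (sZ a) (sYf b) Wy; ring.
rewrite (@partial_sum _ _ W)//; last first.
  by move=> b _; apply: smooth_onB => //; exact: smooth_on_partial.
apply: eq_bigr => b _; rewrite (@partialB _ _ W)//; exact: smooth_on_partial.
Qed.

Lemma sum2B_exchange (P Q P' Q' : 'I_n -> 'I_n -> R) :
  (forall a b, P a b = P' b a) ->
  \sum_a \sum_b (P a b - Q a b) - \sum_a \sum_b (P' a b - Q' a b) =
  - \sum_a \sum_b (Q a b - Q' a b).
Proof.
move=> PP'; have -> : \sum_a \sum_b (P' a b - Q' a b) =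
    \sum_a \sum_b (P a b - Q' a b).
  under eq_bigr do rewrite sumrB; rewrite sumrB exchange_big/= -sumrB.
  by apply: eq_bigr => a _; rewrite -sumrB; apply: eq_bigr => b _; rewrite PP'.
rewrite -sumrB -sumrN; apply: eq_bigr => a _.
by rewrite -sumrB -sumrN; apply: eq_bigr => b _; ring.
Qed.

Lemma formal_adjoint_lie_bracket Y Z f x : smooth_field W Y -> smooth_field W Z ->
  smooth_on W f -> W x ->
  formal_adjoint (lie_bracket Y Z) f x =
  formal_adjoint Z (formal_adjoint Y f) x - formal_adjoint Y (formal_adjoint Z f) x.
Proof.
move=> sY sZ sf Wx; rewrite (formal_adjoint_comp sY sZ sf Wx).
rewrite (formal_adjoint_comp sZ sY sf Wx) sum2B_exchange; last first.
  move=> a b; have sZYf : smooth_on W (fun y => Z y ord0 a * (Y y ord0 b * f y)).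
    by do 2 apply: smooth_onM => //.
  rewrite (partial_comm b a oW sZYf Wx).
  suff -> : (fun y => Z y ord0 a * (Y y ord0 b * f y)) =
            (fun y => Y y ord0 b * (Z y ord0 a * f y)) by [].
  by apply/funext => y; rewrite mulrCA.
rewrite /formal_adjoint; congr (- _); apply: eq_bigr => k _.
(* What survives the cancellation: summed over [b], this is [f] times the [k]-th component of the
   bracket. *)
pose F b y := Y y ord0 b * f y * partial (fun w => Z w ord0 k) b y -
  Z y ord0 b * f y * partial (fun w => Y w ord0 k) b y.
have sF1 b : smooth_on W (fun y => Y y ord0 b * f y * partial (fun w => Z w ord0 k) b y).
  by apply: smooth_onM => //; [exact: smooth_onM|exact/smooth_on_partial/sZ].
have sF2 b : smooth_on W (fun y => Z y ord0 b * f y * partial (fun w => Y w ord0 k) b y).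
  by apply: smooth_onM => //; [exact: smooth_onM|exact/smooth_on_partial/sY].
transitivity (partial (fun y => \sum_b F b y) k x).
  apply: (@eq_partial _ _ W _ _ k oW _ x Wx) => y; rewrite inE => Wy.
  rewrite (lie_bracketE k sY sZ Wy) mulr_suml; apply: eq_bigr => b _.
  by rewrite /F; ring.
rewrite (@partial_sum _ _ W)//; last by move=> b _; exact: smooth_onB.
by apply: eq_bigr => b _; rewrite -(partialB k (sF1 b) (sF2 b) Wx).
Qed.

End commutators.

(** * Measurability and integration on row vectors *)

Section rV_measurability.
Context {R : realType} {n : nat}.
Implicit Types (a b x y v : 'rV[R]_n) (A W : set 'rV[R]_n) (f : 'rV[R]_n -> R).

Definition obox a b : set 'rV[R]_n :=
  [set v | forall i, a ord0 i < v ord0 i < b ord0 i].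

Definition cbox a b : set 'rV[R]_n :=
  [set v | forall i, v ord0 i \in `[a ord0 i, b ord0 i]].

Lemma ball_rVP x (e : R) v : 0 < e ->
  ball x e v <-> forall i, `|x ord0 i - v ord0 i| < e.
Proof.
move=> e0; split=> [[_ xv] i|xv]; first exact: (xv ord0 i).
by split => // i j; rewrite ord1; exact: xv.
Qed.

Lemma measurable_cbox a b : measurable (cbox a b).
Proof.
rewrite (_ : cbox a b = \bigcap_(i : 'I_n)
    ((fun v : 'rV[R]_n => v ord0 i) @^-1` `[a ord0 i, b ord0 i])); last first.
  by apply/seteqP; split => v /= Bv i => [_|]; exact: Bv.
apply: fin_bigcap_measurable => // i _.
by rewrite -[X in measurable X]setTI; exact: measurable_coor.
Qed.

Lemma measurable_obox a b : measurable (obox a b).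
Proof.
rewrite (_ : obox a b = \bigcap_(i : 'I_n)
    ((fun v : 'rV[R]_n => v ord0 i) @^-1` `]a ord0 i, b ord0 i[)); last first.
  by apply/seteqP; split => v /= Bv i => [_|]; have := Bv i; rewrite /= in_itv/=//; exact.
apply: fin_bigcap_measurable => // i _.
by rewrite -[X in measurable X]setTI; exact: measurable_coor.
Qed.

(** Rational corners leave countably many boxes: open sets then belong to the product sigma-algebra,
    and null sets found box by box can be united. The closed box is kept inside [W] because bumps on
    the open box are supported there. *)
Lemma open_rat_box W x : open W -> W x -> exists p : 'rV[rat]_n * 'rV[rat]_n,
  obox (map_mx ratr p.1) (map_mx ratr p.2) x /\
  cbox (map_mx ratr p.1) (map_mx ratr p.2) `<=` W.
Proof.
move=> oW Wx; have /nbhs_ballP[/= r r0 rW] := near_open oW Wx.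
have P (i : 'I_n) : exists q : rat * rat,
    x ord0 i - r < ratr q.1 < x ord0 i /\ x ord0 i < ratr q.2 < x ord0 i + r.
  have [q1] : exists q, ratr q \in `]x ord0 i - r, x ord0 i[%R.
    by apply: rat_in_itvoo; rewrite ltrBlDr ltrDl.
  have [q2] : exists q, ratr q \in `]x ord0 i, x ord0 i + r[%R.
    by apply: rat_in_itvoo; rewrite ltrDl.
  by rewrite !in_itv/= => q2P q1P; exists (q1, q2).
have [q qP] := choice P.
exists (\row_i (q i).1, \row_i (q i).2); split=> [i|v vP].
  by rewrite !mxE; have [/andP[_ ->] /andP[-> _]] := qP i.
apply: rW; apply/ball_rVP => // i; have := vP i; rewrite in_itv/= !mxE.
have [/andP[h1 h2] /andP[h3 h4]] := qP i; move=> /andP[h5 h6].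
by rewrite ltr_norml; apply/andP; split; lra.
Qed.

Lemma open_bigcup_box W : open W ->
  W = \bigcup_(p in [set p : 'rV[rat]_n * 'rV[rat]_n |
        cbox (map_mx ratr p.1) (map_mx ratr p.2) `<=` W])
      obox (map_mx ratr p.1) (map_mx ratr p.2).
Proof.
move=> oW; apply/seteqP; split=> [x Wx|x [p pW px]].
  by have [p [px pW]] := open_rat_box oW Wx; exists p.
by apply: pW => i; have /andP[h1 h2] := px i; rewrite in_itv/= !ltW.
Qed.

Lemma open_measurable_rV W : open W -> measurable W.
Proof.
move=> oW; rewrite (open_bigcup_box oW) bigcup_mkcond.
apply: countable_bigcupT_measurable => // p.
by case: ifPn => // _; exact: measurable_obox.
Qed.

Lemma continuous_measurable_rV W f : open W ->
  (forall x, W x -> {for x, continuous f}) -> measurable_fun W f.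
Proof.
move=> oW cf _; apply: (measurability _ (RGenOInfty.measurableE R)) => //.
move=> /= _ [_ [a ->] <-]; apply: open_measurable_rV; rewrite openE => x [Wx /= fx].
suff fP : nbhs x (f @^-1` `]a, +oo[) by exact: filterI (near_open oW Wx) fP.
apply: (cf x Wx); move: fx; rewrite in_itv/= andbT => /lt_nbhsr.
by apply: filterS => y; rewrite /= in_itv/= andbT.
exact: open_measurable_rV.
Qed.

Lemma lebesgue_rV_cbox_lty a b : (lebesgue_rV n (cbox a b) < +oo)%E.
Proof.
have [ab|/existsNP[i abi]] := pselect (forall i, a ord0 i <= b ord0 i).
  by rewrite lebesgue_rV_box// ltry.
rewrite (_ : cbox a b = set0) ?measure0//; apply/seteqP; split => // v /(_ i).
by rewrite in_itv/= => /andP[] /le_trans/[apply].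
Qed.

Lemma compact_cbox A : compact A -> exists2 M : R, 0 < M &
  A `<=` cbox (const_mx (- M)) (const_mx M).
Proof.
move=> /compact_bounded[M [_ MA]]; exists (`|M| + 1); first by rewrite ltr_wpDl.
move=> x /(MA (`|M| + 1)); rewrite ltr_pwDr ?ler_norm// => /(_ isT) xM i.
rewrite in_itv/= !mxE -ler_norml (le_trans _ xM)// /Num.Def.normr/= mx_normrE.
exact: (le_bigmax _ (fun ij => `|x ij.1 ij.2|) (ord0, i)).
Qed.

End rV_measurability.

(** * Fubini by coordinates; integrals of compactly supported derivatives *)

Section integration_rV.
Context {R : realType}.

Lemma integrable_bounded_box n (D : set 'rV[R]_n) (f : 'rV[R]_n -> R) (a b : 'rV[R]_n) (M : R) :
  measurable D -> measurable_fun D f -> (forall x, D x -> `|f x| <= M) ->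
  (forall x, D x -> ~ cbox a b x -> f x = 0) ->
  (lebesgue_rV n).-integrable D (EFin \o f).
Proof.
move=> mD mf fM f0.
have mK := measurable_cbox a b.
suff : (lebesgue_rV n).-integrable D ((EFin \o f) \_ (cbox a b)).
  apply: eq_integrable => // x; rewrite inE => Dx; rewrite /patch.
  by case: ifPn => // /negP xK; rewrite /= f0// => Kx; apply: xK; rewrite inE.
apply/integrable_restrict => //.
apply: measurable_bounded_integrable; first exact: measurableI.
- apply: le_lt_trans (lebesgue_rV_cbox_lty a b); apply: le_measure; rewrite ?inE//.
  exact: measurableI.
- exact: measurable_funS mf.
- exists M; split; first exact: num_real.
  by move=> r Mr x [Dx _]; exact: le_trans (fM _ Dx) (ltW Mr).
Qed.

Lemma rV_consE0 n (x : R) (w : 'rV[R]_n) : rV_cons (x, w) ord0 ord0 = x.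
Proof. exact: (congr1 fst (rV_consK (x, w))). Qed.

Lemma rV_consES n (x : R) (w : 'rV[R]_n) j : rV_cons (x, w) ord0 (lift ord0 j) = w ord0 j.
Proof.
by have /(congr1 (fun q : _ * 'rV[R]_n => q.2 ord0 j)) := rV_consK (x, w); rewrite mxE.
Qed.

Lemma integrable_rV_cons n (f : 'rV[R]_n.+1 -> \bar R) :
  (lebesgue_rV n.+1).-integrable setT f ->
  (@lebesgue_measure R \x lebesgue_rV n)%E.-integrable setT (f \o @rV_cons R n).
Proof.
move=> /integrableP[mf foo]; apply/integrableP; split.
  exact: measurableT_comp mf (@measurable_rV_cons _ _).
move: foo; rewrite /= /rV_cons_measure (ge0_integral_pushforward (@measurable_rV_cons _ _))//.
exact: measurableT_comp.
Qed.

Lemma integral_rV_cons n (f : 'rV[R]_n.+1 -> \bar R) :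
  (lebesgue_rV n.+1).-integrable setT f ->
  (\int[lebesgue_rV n.+1]_x f x =
   \int[@lebesgue_measure R \x lebesgue_rV n]_p f (rV_cons p))%E.
Proof.
move=> fi; have mf := measurable_int _ fi.
rewrite /= /rV_cons_measure (integral_pushforward (@measurable_rV_cons _ _))//.
exact: integrable_rV_cons.
Qed.

Lemma fubini_rV_cons1 n (f : 'rV[R]_n.+1 -> \bar R) :
  (lebesgue_rV n.+1).-integrable setT f ->
  (\int[lebesgue_rV n.+1]_x f x =
   \int[@lebesgue_measure R]_x \int[lebesgue_rV n]_w f (rV_cons (x, w)))%E.
Proof.
move=> fi; rewrite integral_rV_cons// -integral12_prod_meas1//.
exact: integrable_rV_cons.
Qed.

Lemma fubini_rV_cons2 n (f : 'rV[R]_n.+1 -> \bar R) :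
  (lebesgue_rV n.+1).-integrable setT f ->
  (\int[lebesgue_rV n.+1]_x f x =
   \int[lebesgue_rV n]_w \int[@lebesgue_measure R]_x f (rV_cons (x, w)))%E.
Proof.
move=> fi; rewrite integral_rV_cons// -integral21_prod_meas1//.
exact: integrable_rV_cons.
Qed.

Lemma continuous_rV_cons2 n (x : R) : continuous (fun w : 'rV[R]_n => rV_cons (x, w)).
Proof.
move=> w A /= /nbhs_ballP[r /= r0 rA]; apply/nbhs_ballP; exists r => //= v /ball_rVP wv.
apply: rA; apply/ball_rVP => // i; case: (unliftP ord0 i) => [j|] ->{i}.
  by rewrite !rV_consES; exact: wv.
by rewrite !rV_consE0 subrr normr0.
Qed.

Lemma continuous_rV_cons1 n (w : 'rV[R]_n) : continuous (fun x : R => rV_cons (x, w)).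
Proof.
move=> x A /= /nbhs_ballP[r /= r0 rA]; apply/nbhs_ballP; exists r => //= y xy.
apply: rA; apply/ball_rVP => // i; case: (unliftP ord0 i) => [j|] ->{i}.
  by rewrite !rV_consES subrr normr0.
by rewrite !rV_consE0.
Qed.

Lemma is_derive_rV_consS n (g : 'rV[R]_n.+1 -> R) x (w : 'rV[R]_n) j (d : R) :
  is_derive (rV_cons (x, w)) (base_vec (lift ord0 j)) g d ->
  is_derive w (base_vec j) (fun w => g (rV_cons (x, w))) d.
Proof.
move=> [gd <-].
have Ec (h : R) : rV_cons (x, h *: base_vec j + w) =
    h *: base_vec (lift ord0 j) + rV_cons (x, w).
  apply/rowP => i; case: (unliftP ord0 i) => [l|] ->{i}.
    by rewrite [RHS]mxE !rV_consES !mxE (inj_eq lift_inj).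
  by rewrite [RHS]mxE !rV_consE0 !mxE (negbTE (neq_lift _ _)) andbF mulr0 add0r.
have E : (fun h : R => h^-1 *: (((fun w => g (rV_cons (x, w))) \o shift w) (h *: base_vec j)
      - g (rV_cons (x, w)))) =
    (fun h => h^-1 *: ((g \o shift (rV_cons (x, w))) (h *: base_vec (lift ord0 j))
      - g (rV_cons (x, w)))).
  by apply/funext => h; congr (_ *: (g _ - _)); exact: Ec.
by apply: DeriveDef; rewrite /derivable /derive E.
Qed.

Lemma is_derive_rV_cons0 n (g : 'rV[R]_n.+1 -> R) x (w : 'rV[R]_n) (d : R) :
  is_derive (rV_cons (x, w)) (base_vec ord0) g d ->
  is_derive x (1 : R) (fun x : R => g (rV_cons (x, w))) d.
Proof.
move=> [gd <-].
have Ec (h : R) : rV_cons (h *: (1 : R) + x, w) = h *: base_vec ord0 + rV_cons (x, w).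
  apply/rowP => i; case: (unliftP ord0 i) => [l|] ->{i}.
    by rewrite [RHS]mxE !rV_consES !mxE mulr0 add0r.
  by rewrite [RHS]mxE !rV_consE0 !mxE.
have E : (fun h : R => h^-1 *: (((fun x : R => g (rV_cons (x, w))) \o shift x) (h *: (1 : R))
      - g (rV_cons (x, w)))) =
    (fun h => h^-1 *: ((g \o shift (rV_cons (x, w))) (h *: base_vec ord0)
      - g (rV_cons (x, w)))).
  by apply/funext => h; congr (_ *: (g _ - _)); exact: Ec.
by apply: DeriveDef; rewrite /derivable /derive E.
Qed.

Lemma integral_derive_eq0 (h dh : R -> R) (M : R) : 0 < M ->
  (forall x, is_derive x (1 : R) h (dh x)) -> continuous dh ->
  (forall x, M < `|x| -> h x = 0 /\ dh x = 0) ->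
  (\int[@lebesgue_measure R]_x (dh x)%:E = 0)%E.
Proof.
(* Vanishing is assumed only for [M < |x|]; the shift by 1 puts both endpoints strictly in that
   region. *)
move=> M0 hd dc h0; pose N := M + 1.
have NN : - N < N by rewrite /N; lra.
have hN : h N = 0 by apply: (h0 _ _).1; rewrite gtr0_norm /N; lra.
have hNN : h (- N) = 0 by apply: (h0 _ _).1; rewrite normrN gtr0_norm /N; lra.
have hc : continuous h.
  by move=> x; apply/differentiable_continuous/derivable1_diffP; have [] := hd x.
have -> : (\int[@lebesgue_measure R]_x (dh x)%:E =
    \int[@lebesgue_measure R]_(x in `[(- N)%R, N]) (dh x)%:E)%E.
  rewrite [RHS]integral_mkcond; apply: eq_integral => x _; rewrite /patch.
  case: ifPn => //; rewrite notin_setE/= in_itv/= => /negP.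
  rewrite -ler_norml -ltNge => Nx; rewrite (h0 _ _).2// (lt_trans _ Nx)// /N; lra.
rewrite (@continuous_FTC2 _ dh h)//; last 3 first.
- exact: continuous_subspaceT.
- split.
  + by move=> x _; have [] := hd x.
  + exact/cvg_at_right_filter/hc.
  + exact/cvg_at_left_filter/hc.
- by move=> x _; rewrite derive1E; have [_ ->] := hd x.
by rewrite hN hNN subee.
Qed.

(** The derivative is a separate function [dg] so that slices of the pair satisfy the same
    hypotheses. If [k] is a later coordinate, the inner integral is taken over the tail and vanishes
    by induction; if [k] is the first one, the other order of integration applies, with the
    one-variable case inside. *)
Lemma integral_partial_eq0 n (k : 'I_n) (g dg : 'rV[R]_n -> R) (M : R) : 0 < M ->
  (forall x, is_derive x (base_vec k) g (dg x)) -> continuous dg ->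
  (exists C, forall x, `|dg x| <= C) ->
  (forall x, ~ cbox (const_mx (- M)) (const_mx M) x -> g x = 0 /\ dg x = 0) ->
  (\int[lebesgue_rV n]_x (dg x)%:E = 0)%E.
Proof.
elim: n => [|n IH] in k g dg *; first by case: k.
move=> M0 gd dc [C dC] g0.
have dgi : (lebesgue_rV n.+1).-integrable setT (EFin \o dg).
  apply: (@integrable_bounded_box _ _ _ (const_mx (- M)) (const_mx M) C) => //.
    by apply: continuous_measurable_rV => [|x _]; [exact: openT|exact: dc].
  by move=> x _ /g0[].
case: (unliftP ord0 k) gd => [j|] ->{k} gd.
  rewrite fubini_rV_cons1// integral0_eq// => x _ /=.
  apply: (IH j (fun w => g (rV_cons (x, w))) (fun w => dg (rV_cons (x, w)))) => //.
  - by move=> w; apply: is_derive_rV_consS; exact: gd.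
  - by move=> w; apply: continuous_comp; [exact: continuous_rV_cons2|exact: dc].
  - by exists C => w; exact: dC.
  - move=> w wM; apply: g0 => xwM; apply: wM => i.
    by have := xwM (lift ord0 i); rewrite rV_consES !mxE.
rewrite fubini_rV_cons2// integral0_eq// => w _ /=.
apply: (@integral_derive_eq0 (fun x => g (rV_cons (x, w))) _ M) => //.
- by move=> x; apply: is_derive_rV_cons0; exact: gd.
- by move=> x; apply: continuous_comp; [exact: continuous_rV_cons1|exact: dc].
- move=> x Mx; apply: g0 => /(_ ord0); rewrite rV_consE0 !mxE in_itv/= -ler_norml.
  by rewrite leNgt Mx.
Qed.

End integration_rV.

(** * Test functions *)

Section test_functions.
Context {R : realType} {n : nat}.
Implicit Types (A B D : set 'rV[R]_n) (f g h phi : 'rV[R]_n -> R).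
Local Notation mu := (lebesgue_rV n).

Lemma C_onU A B k f : C_on A k f -> C_on B k f -> C_on (A `|` B) k f.
Proof.
elim: k f => [|k IH] f [fA dA] [fB dB]; split => //.
- by move=> x [/fA|/fB].
- by move=> x [/fA|/fB].
move=> i; have [fAi CAi] := dA i; have [fBi CBi] := dB i.
by split; [move=> x [/fAi|/fBi]|exact: IH].
Qed.

Lemma smooth_onU A B f : smooth_on A f -> smooth_on B f -> smooth_on (A `|` B) f.
Proof. by move=> fA fB k; exact: C_onU. Qed.

Lemma open_setC_closure A : open (~` closure A).
Proof. by apply: closed_openC; exact: closed_closure. Qed.

Lemma test_function_sub A f g : test_function A f -> smooth_on setT g ->
  (forall x, g x != 0 -> closure [set x | f x != 0] x) -> test_function A g.
Proof.
move=> [sf cf fA] sg gf.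
have gfS : closure [set x | g x != 0] `<=` closure [set x | f x != 0].
  rewrite [X in _ `<=` X]((closure_id _).1 (@closed_closure _ [set x | f x != 0])).
  by apply: closureS => x; exact: gf.
split=> //; last exact: subset_trans fA.
by apply: subclosed_compact gfS => //; exact: closed_closure.
Qed.

Lemma test_function_subset A B f : A `<=` B -> test_function A f -> test_function B f.
Proof. by move=> AB [sf cf fA]; split=> //; exact: subset_trans AB. Qed.

Lemma test_function_eq0 A f x : test_function A f -> ~ A x -> f x = 0.
Proof.
move=> [_ _ fA] Ax; apply: contra_notP Ax => /eqP fx; apply: fA.
exact: subset_closure.
Qed.

Lemma test_function_supp0 f x : ~ closure [set x | f x != 0] x -> f x = 0.
Proof. by move=> Sx; apply: contra_notP Sx => /eqP fx; exact: subset_closure. Qed.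

Lemma partial_supp0 f k x : ~ closure [set x | f x != 0] x -> partial f k x = 0.
Proof.
have fS : {in ~` closure [set x | f x != 0], f =1 cst 0}.
  by move=> y; rewrite inE => Sy; exact: test_function_supp0.
move=> Sx; have -> := eq_partial k (@open_setC_closure _) fS Sx.
exact: partial_cst.
Qed.

(** [h] may be irregular outside [A]: the product is smooth on [A], vanishes off the support of [f],
    and these two open sets cover the space. *)
Lemma test_functionM A f h : open A -> test_function A f -> smooth_on A h ->
  test_function A (fun x => h x * f x).
Proof.
move=> oA tf sh; have [sf cf fA] := tf.
apply: (test_function_sub tf) => [|x]; last first.
  by rewrite mulf_eq0 negb_or => /andP[_ fx]; exact: subset_closure.
rewrite (_ : setT = A `|` ~` closure [set x | f x != 0]); last first.
  apply/esym; rewrite -subTset => x _.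
  by have [/fA|] := pselect (closure [set x | f x != 0] x); [left|right].
apply: smooth_onU.
  by apply: smooth_onM => //; exact: smooth_on_subset sf.
apply: (@eq_smooth_on _ _ _ (cst 0)); [exact: open_setC_closure|move=> x; rewrite inE => Sx; by rewrite (test_function_supp0 Sx) mulr0|exact: smooth_on_cst].
Qed.

Lemma test_functionZ A f (a : R) : test_function A f -> test_function A (fun x => a * f x).
Proof.
move=> tf; have [sf _ _] := tf; apply: (test_function_sub tf).
  by apply: smooth_onZ => //; exact: openT.
by move=> x; rewrite mulf_eq0 negb_or => /andP[_ fx]; exact: subset_closure.
Qed.

Lemma test_functionD A f g : test_function A f -> test_function A g ->
  test_function A (fun x => f x + g x).
Proof.
move=> [sf cf fA] [sg cg gA].
have S : closure [set x | f x + g x != 0] `<=`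
    closure [set x | f x != 0] `|` closure [set x | g x != 0].
  rewrite [X in _ `<=` X](closure_id _).1; last first.
    by apply: closedU; exact: closed_closure.
  apply: closureS => x /= fg; have [fx|fx] := eqVneq (f x) 0.
    by right; apply: subset_closure; move: fg; rewrite /= fx add0r.
  by left; exact: subset_closure.
split; first by apply: smooth_onD => //; exact: openT.
  by apply: subclosed_compact S; [exact: closed_closure|exact: compactU].
by apply: subset_trans S _; rewrite subUset.
Qed.

Lemma test_function_partial A f k : test_function A f -> test_function A (partial f k).
Proof.
move=> tf; have [sf _ _] := tf; apply: (test_function_sub tf).
  exact: smooth_on_partial.
by move=> x; apply: contra_neqP; exact: partial_supp0.
Qed.

Lemma test_function_box A f : test_function A f -> exists2 M : R, 0 < M &
  forall x, ~ cbox (const_mx (- M)) (const_mx M) x -> ~ closure [set x | f x != 0] x.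
Proof. by move=> [_ /compact_cbox[M M0 fM] _]; exists M => // x; apply: contra_not => /fM. Qed.

Lemma test_function_continuous A f : test_function A f -> continuous f.
Proof. by move=> [sf _ _] x; exact: smooth_on_continuous sf _. Qed.

Lemma test_function_measurable A f D : test_function A f -> measurable_fun D f.
Proof.
move=> tf; apply: measurable_funTS; apply: continuous_measurable_rV => [|x _].
  exact: openT.
exact: test_function_continuous tf x.
Qed.

Lemma continuous_bounded_compact A f : compact A -> {within A, continuous f} ->
  exists2 M : R, 0 <= M & forall x, A x -> `|f x| <= M.
Proof.
move=> cA cf; have /compact_bounded[M [_ MA]] := continuous_compact cf cA.
exists (`|M| + 1); first by rewrite addr_ge0.
by move=> x Ax; apply: MA; [rewrite ltr_pwDr// ler_norm|exists x].
Qed.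

Lemma test_function_bounded A f : test_function A f ->
  exists2 M : R, 0 <= M & forall x, `|f x| <= M.
Proof.
move=> tf; have [sf cf fA] := tf.
have fc : {within closure [set x | f x != 0], continuous f}.
  by apply: continuous_subspaceT; exact: test_function_continuous tf.
have [M M0 fM] := continuous_bounded_compact cf fc.
exists M => // x; have [/fM//|Sx] := pselect (closure [set x | f x != 0] x).
by rewrite (test_function_supp0 Sx) normr0.
Qed.

Lemma test_function_integrable A f D : measurable D -> test_function A f ->
  mu.-integrable D (EFin \o f).
Proof.
move=> mD tf; have [M _ fM] := test_function_bounded tf.
have [N _ fN] := test_function_box tf.
apply: (@integrable_bounded_box _ _ _ _ (const_mx (- N)) (const_mx N) M) => //.
- exact: test_function_measurable tf.
- by move=> x _ /fN; exact: test_function_supp0.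
Qed.

Lemma test_function_integral_partial A f k : test_function A f ->
  \int[mu]_x partial f k x = 0.
Proof.
move=> tf; have [M M0 fM] := test_function_box tf; have [sf _ _] := tf.
have tp := test_function_partial k tf; have [C _ pC] := test_function_bounded tp.
suff -> : Rintegral mu setT (partial f k) = fine 0 by [].
congr fine; apply: (@integral_partial_eq0 _ _ k f _ M) => //.
- by move=> x; apply/derivableP; exact: (smooth_on_derivable (A := setT)).
- exact: test_function_continuous tp.
- by exists C.
- by move=> x /fM fx; split; [exact: test_function_supp0|exact: partial_supp0].
Qed.

Lemma Rintegral_test_function A D f : A `<=` D -> test_function A f ->
  \int[mu]_(x in D) f x = \int[mu]_x f x.
Proof.
move=> AD tf; rewrite Rintegral_mkcond; apply: eq_Rintegral => x _.
rewrite /patch; case: ifPn => // /negP xD; rewrite (test_function_eq0 tf)//.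
by move=> Ax; apply: xD; rewrite inE; exact: AD.
Qed.

Definition field_derive (Y : 'rV[R]_n -> 'rV[R]_n) f x : R :=
  \sum_k Y x ord0 k * partial f k x.

Lemma test_function_sum A I (s : seq I) (F : I -> 'rV[R]_n -> R) :
  (forall i, test_function A (F i)) -> test_function A (fun x => \sum_(i <- s) F i x).
Proof.
move=> tF; elim: s => [|i s IH].
  under eq_fun do rewrite big_nil; split; first exact: smooth_on_cst.
    rewrite (_ : [set _ | _] = set0) ?closure0; first exact: compact0.
    by apply/seteqP; split => // x /=; rewrite eqxx.
  rewrite (_ : [set _ | _] = set0) ?closure0//.
  by apply/seteqP; split => // x /=; rewrite eqxx.
by under eq_fun do rewrite big_cons; exact: test_functionD.
Qed.

Lemma test_function_field_derive A Y f : open A -> smooth_field A Y ->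
  test_function A f -> test_function A (field_derive Y f).
Proof.
move=> oA sY tf; apply: test_function_sum => k.
by apply: test_functionM => //; exact: test_function_partial.
Qed.

(** The two integrands differ by the divergence of the field with components [Y_k * g * f], which
    are test functions on [A]. *)
Lemma integration_by_parts_field A Y f g : open A -> smooth_field A Y ->
  test_function A f -> smooth_on A g ->
  \int[mu]_x (g x * field_derive Y f x) = \int[mu]_x (formal_adjoint Y g x * f x).
Proof.
move=> oA sY tf sg; have [sf _ _] := tf.
have sYg k : smooth_on A (fun x => Y x ord0 k * g x) by apply: smooth_onM.
have tYgf k : test_function A (fun x => Y x ord0 k * g x * f x) by exact: test_functionM.
have t1 : test_function A (fun x => g x * field_derive Y f x).
  by apply: test_functionM => //; exact: test_function_field_derive.
have t2 : test_function A (fun x => formal_adjoint Y g x * f x).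
  by apply: test_functionM => //; exact: smooth_formal_adjoint.
apply/eqP; rewrite -subr_eq0 -RintegralB//; [|exact: test_function_integrable t1|
  exact: test_function_integrable t2].
pose F x := \sum_k partial (fun x => Y x ord0 k * g x * f x) k x.
have E : (fun x => g x * field_derive Y f x - formal_adjoint Y g x * f x) = F.
  apply/funext => x; have [Ax|nAx] := pselect (A x); last first.
    rewrite (test_function_eq0 t1)// (test_function_eq0 t2)// subr0 /F big1// => k _.
    by rewrite (test_function_eq0 (test_function_partial k (tYgf k))).
  rewrite /F /field_derive /formal_adjoint mulNr opprK mulr_sumr mulr_suml -big_split/=.
  apply: eq_bigr => k _.
  have sfA : smooth_on A f by exact: smooth_on_subset sf.
  by rewrite (partialM k (sYg k) sfA Ax); ring.
rewrite (_ : (fun x => _ - _) = F)// -/F.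
have tF k : test_function A (partial (fun x => Y x ord0 k * g x * f x) k).
  exact: test_function_partial.
apply/eqP; rewrite /F; elim: (index_enum 'I_n) => [|k s IH].
  under eq_Rintegral do rewrite big_nil.
  by rewrite Rintegral_cst// mul0r.
under eq_Rintegral do rewrite big_cons.
rewrite RintegralD//; last 2 first.
- exact: test_function_integrable (tF k).
- exact: test_function_integrable (test_function_sum s tF).
by rewrite IH addr0; exact: test_function_integral_partial (tYgf k).
Qed.

End test_functions.

(** * Poincare inequality for test functions *)

Section dominated_weights.
Context {R : realType} {n m : nat}.
Variables (X : 'I_m -> 'rV[R]_n -> 'rV[R]_n) (W Omega : set 'rV[R]_n).
Hypotheses (oW : open W) (sX : forall j, smooth_field W (X j)).
Hypotheses (oO : open Omega) (OW : compactly_included Omega W).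
Local Notation mu := (lebesgue_rV n).
Implicit Types (f g phi psi : 'rV[R]_n -> R).

(** Classical counterpart of [sqgrad]; the latter uses chosen representatives of weak derivatives
    and is determined only almost everywhere. *)
Definition test_sqgrad phi (x : 'rV[R]_n) : R :=
  \sum_j field_derive (X j) phi x ^+ 2.

(** Real-valued integrals can be added and compared only for integrable functions; this is part of
    domination because some weights are indicators and not smooth. *)
Definition weightable psi := forall phi, test_function Omega phi ->
  mu.-integrable setT (EFin \o (fun x => psi x * phi x ^+ 2)).

(* The weights psi for which the quadratic form [phi |-> \int psi phi^2] has
   relative bound 0 with respect to the energy. *)
Definition dominated psi := weightable psi /\
  forall e : R, 0 < e -> exists2 C : R, 0 <= C &
    forall phi, test_function Omega phi ->
      \int[mu]_x (psi x * phi x ^+ 2) <=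
      e * \int[mu]_x (phi x ^+ 2) + C * \int[mu]_x test_sqgrad phi x.

Lemma Omega_subW : Omega `<=` W.
Proof. by move=> x Ox; apply: OW.2; exact: subset_closure. Qed.

Lemma smooth_field_Omega j : smooth_field Omega (X j).
Proof. by move=> k; apply: smooth_on_subset (sX j k); exact: Omega_subW. Qed.

Lemma test_function_sqr A phi : open A -> test_function A phi ->
  test_function A (fun x => phi x ^+ 2).
Proof.
move=> oA tp; have [sp _ _] := tp.
rewrite (_ : (fun x => _) = fun x => phi x * phi x).
  by apply: test_functionM => //; exact: smooth_on_subset sp.
by apply/funext => x; rewrite expr2.
Qed.

Lemma test_function_sqgrad phi : test_function Omega phi ->
  test_function Omega (test_sqgrad phi).
Proof.
move=> tp; apply: test_function_sum => j; apply: test_function_sqr => //.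
by apply: test_function_field_derive => //; exact: smooth_field_Omega.
Qed.

Lemma test_sqgrad_ge0 phi x : 0 <= test_sqgrad phi x.
Proof. by apply: sumr_ge0 => j _; exact: sqr_ge0. Qed.

Lemma weightable_smooth psi : smooth_on Omega psi -> weightable psi.
Proof.
move=> spsi phi tp; apply: (@test_function_integrable _ _ Omega) => //.
by apply: test_functionM => //; exact: test_function_sqr.
Qed.

Lemma weightable_indic U : open U -> weightable (\1_U).
Proof.
move=> oU phi tp; have t2 := test_function_sqr oO tp.
apply: (le_integrable _ _ _ (test_function_integrable (@measurableT _ _) t2)) => //.
  apply/measurable_EFinP; apply: measurable_funM.
    by apply: measurable_indic; exact: open_measurable_rV.
  exact: test_function_measurable t2.
move=> x _ /=; rewrite lee_fin normrM indicE ler_piMl//.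
by rewrite ger0_norm// lern1 leq_b1.
Qed.

Lemma weightableD psi1 psi2 : weightable psi1 -> weightable psi2 ->
  weightable (fun x => psi1 x + psi2 x).
Proof.
move=> w1 w2 phi tp; apply: eq_integrable (integrableD _ (w1 _ tp) (w2 _ tp)) => //.
by move=> x _; rewrite /= -EFinD -mulrDl.
Qed.

Lemma weightableZ c psi : weightable psi -> weightable (fun x => c * psi x).
Proof.
move=> w phi tp; apply: eq_integrable (integrableZl _ c (w _ tp)) => //.
by move=> x _; rewrite /= -EFinM mulrA.
Qed.

Lemma dominatedD psi1 psi2 : dominated psi1 -> dominated psi2 ->
  dominated (fun x => psi1 x + psi2 x).
Proof.
move=> [w1 d1] [w2 d2]; split=> [|e e0]; first exact: weightableD.
have e20 : 0 < e / 2 by rewrite divr_gt0.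
have [C1 C10 h1] := d1 _ e20; have [C2 C20 h2] := d2 _ e20.
exists (C1 + C2) => [|phi tp]; first exact: addr_ge0.
under eq_Rintegral do rewrite mulrDl.
rewrite RintegralD//; [|exact: w1|exact: w2].
apply: (le_trans (lerD (h1 _ tp) (h2 _ tp))); lra.
Qed.

Lemma dominatedZ c psi : 0 <= c -> dominated psi -> dominated (fun x => c * psi x).
Proof.
move=> c0 [w d]; split=> [|e e0]; first exact: weightableZ.
(* Dividing by [c + 1] rather than [c] covers [c = 0]. *)
have [C C0 h] := d (e / (c + 1)) (divr_gt0 e0 (ltr_wpDl c0 ltr01)).
exists (c * C) => [|phi tp]; first exact: mulr_ge0.
under eq_Rintegral do rewrite -mulrA.
rewrite RintegralZl//; last exact: w.
have ce : c * (e / (c + 1)) <= e.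
  by rewrite mulrA ler_pdivrMr ?ltr_wpDl// mulrC ler_wpM2l ?lerDl ?ltW.
apply: (le_trans (ler_wpM2l c0 (h _ tp))).
rewrite mulrDr (mulrA c C) lerD2r mulrA ler_wpM2r//.
by apply: Rintegral_ge0 => x _; exact: sqr_ge0.
Qed.

(** Domination is an upper bound on the form, so [psi] may be very negative; only [Omega] matters,
    since test functions vanish elsewhere. *)
Lemma dominated_le psi psi' : weightable psi -> dominated psi' ->
  (forall x, Omega x -> psi x <= psi' x) -> dominated psi.
Proof.
move=> w [w' d'] le_psi; split=> // e e0; have [C C0 h] := d' e e0.
exists C => // phi tp; apply: le_trans (h _ tp); apply: le_Rintegral => //.
- exact: w.
- exact: w'.
move=> x _; have [Ox|Ox] := pselect (Omega x).
  by rewrite ler_wpM2r ?sqr_ge0// le_psi.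
by rewrite (test_function_eq0 tp Ox) expr0n !mulr0.
Qed.

Lemma field_derive_sqr Y phi x : smooth_on setT phi ->
  field_derive Y (fun y => phi y ^+ 2) x = 2 * phi x * field_derive Y phi x.
Proof.
move=> sp; rewrite /field_derive mulr_sumr; apply: eq_bigr => k _.
rewrite (_ : (fun y => phi y ^+ 2) = (fun y => phi y * phi y)); last first.
  by apply/funext => y; rewrite expr2.
by rewrite (partialM k sp sp I); ring.
Qed.

(* AM-GM: [2 f phi d <= e phi^2 + (K^2 / e) d^2] *)
Lemma dominated_formal_adjoint j f : smooth_on W f ->
  dominated (formal_adjoint (X j) f).
Proof.
move=> sf; have sfO := smooth_on_subset Omega_subW sf.
have sXO := @smooth_field_Omega j.
split=> [|e e0]; first by apply: weightable_smooth; exact: smooth_formal_adjoint.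
(* Smoothness of [f] up to the compact closure of [Omega] supplies the bound [K]; weights are
   therefore built from functions smooth on [W], not just on [Omega]. *)
have cf : {within closure Omega, continuous f}.
  apply: continuous_in_subspaceT => x; rewrite inE => /OW.2 Wx.
  exact: smooth_on_continuous sf Wx.
have [K K0 fK] := continuous_bounded_compact OW.1 cf.
exists (K ^+ 2 / e) => [|phi tp]; first by rewrite divr_ge0 ?sqr_ge0// ltW.
have [sp _ _] := tp.
have t2 := test_function_sqr oO tp; have tg := test_function_sqgrad tp.
have td := test_function_field_derive oO sXO tp.
rewrite -(integration_by_parts_field oO sXO t2 sfO).
have it2 := test_function_integrable (@measurableT _ _) t2.
have itg := test_function_integrable (@measurableT _ _) tg.
rewrite -RintegralZl// -RintegralZl// -RintegralD//; last 2 first.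
- exact: integrableZl it2.
- exact: integrableZl itg.
apply: le_Rintegral => //.
- apply: (@test_function_integrable _ _ Omega) => //.
  by apply: test_functionM => //; exact: test_function_field_derive.
- exact: (integrableD _ (integrableZl _ e it2) (integrableZl _ (K ^+ 2 / e) itg)).
move=> x _; rewrite field_derive_sqr//.
have [Ox|Ox] := pselect (Omega x); last first.
  rewrite (test_function_eq0 tp Ox) mulr0 mul0r mulr0 expr0n mulr0 add0r.
  by rewrite mulr_ge0 ?test_sqgrad_ge0// divr_ge0 ?sqr_ge0// ltW.
have fx : f x ^+ 2 <= K ^+ 2.
  by rewrite -real_normK ?num_real// lerXn2r ?nnegrE// fK//; exact: subset_closure.
have dS : field_derive (X j) phi x ^+ 2 <= test_sqgrad phi x.
  rewrite /test_sqgrad (bigD1 j)//= lerDl; apply: sumr_ge0 => i _; exact: sqr_ge0.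
apply: (@le_trans _ _ (e * phi x ^+ 2 + K ^+ 2 / e * field_derive (X j) phi x ^+ 2)).
  set p := phi x; set d := field_derive _ _ _.
  rewrite -subr_ge0 [leRHS](_ : _ =
    ((e * p - f x * d) ^+ 2 + (K ^+ 2 - f x ^+ 2) * d ^+ 2) / e); last first.
    by field; rewrite gt_eqF.
  apply: divr_ge0; last exact: ltW.
  by rewrite addr_ge0 ?sqr_ge0// mulr_ge0 ?sqr_ge0// subr_ge0.
by rewrite lerD2l ler_wpM2l// divr_ge0 ?sqr_ge0// ltW.
Qed.

Lemma formal_adjointN Y f x : smooth_field W Y -> smooth_on W f -> W x ->
  formal_adjoint Y (fun y => - f y) x = - formal_adjoint Y f x.
Proof.
move=> sY sf Wx; rewrite /formal_adjoint; congr (- _); rewrite -sumrN; apply: eq_bigr => k _.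
have sYf : smooth_on W (fun y => Y y ord0 k * f y) by exact: smooth_onM.
rewrite -(partialN k sYf Wx); suff -> : (fun y => Y y ord0 k * - f y) =
  (fun y => - (Y y ord0 k * f y)) by [].
by apply/funext => y; rewrite mulrN.
Qed.

(** The quantifier over all smooth [f] carries the induction: the hypothesis for one field is used
    at the adjoint of the other applied to [f]. Domination survives only nonnegative multiples, so
    the minus sign of the bracket identity is moved onto the function, as [Y^* (- Z^* f)]. *)
Lemma dominated_commutator l Y : commutator X l Y ->
  smooth_field W Y /\ forall f, smooth_on W f -> dominated (formal_adjoint Y f).
Proof.
elim=> [j|k k' Y' Z _ [sY dY] _ [sZ dZ]].
  by split=> // f sf; exact: dominated_formal_adjoint.
split; first exact: smooth_lie_bracket.
move=> f sf; have sYf := smooth_formal_adjoint oW sY sf.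
have sZf := smooth_formal_adjoint oW sZ sf.
apply: (dominated_le _ (dominatedD (dZ _ sYf) (dY _ (smooth_onN oW sZf)))).
  apply: weightable_smooth; apply: smooth_on_subset Omega_subW _.
  by apply: smooth_formal_adjoint => //; exact: smooth_lie_bracket.
move=> x /Omega_subW Wx; rewrite (formal_adjoint_lie_bracket oW sY sZ sf Wx).
by rewrite (formal_adjointN sY sZf Wx).
Qed.

End dominated_weights.

(** * Divergences as dominated weights *)

Section propagation.
Context {R : realType} {n m : nat}.
Variables (X : 'I_m -> 'rV[R]_n -> 'rV[R]_n) (W Omega : set 'rV[R]_n).
Hypotheses (oW : open W) (sX : forall j, smooth_field W (X j)).
Hypotheses (oO : open Omega) (OW : compactly_included Omega W).
Hypothesis hX : hormander_condition X W.
Local Notation mu := (lebesgue_rV n).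
Local Notation dominated := (dominated X Omega).
Local Notation weightable := (@weightable R n Omega).

Lemma dominated0 : dominated (fun=> 0).
Proof.
have w0 : weightable (fun=> 0) by apply: weightable_smooth => //; exact: smooth_on_cst.
split=> // e e0; exists 0 => // phi _; rewrite mul0r addr0.
under eq_Rintegral do rewrite mul0r.
rewrite Rintegral_cst// mul0r; apply: mulr_ge0; first exact: ltW.
by apply: Rintegral_ge0 => x _; exact: sqr_ge0.
Qed.

Lemma dominated_sum I (s : seq I) (F : I -> 'rV[R]_n -> R) :
  (forall i, dominated (F i)) -> dominated (fun x => \sum_(i <- s) F i x).
Proof.
move=> dF; elim: s => [|i s IH].
  by under eq_fun do rewrite big_nil; exact: dominated0.
by under eq_fun do rewrite big_cons; exact: dominatedD.
Qed.

(* Near x0, multiplying by the adjugate of n independent commutators turns the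
   adjoints of these commutators into the divergence, up to the weight E. *)
Lemma dominated_divergence x0 : W x0 -> exists2 E : 'rV[R]_n -> R,
  smooth_on W E /\ 0 < E x0 &
  forall p : 'I_n -> 'rV[R]_n -> R, (forall k, smooth_on W (p k)) ->
    dominated (fun x => - \sum_k partial (fun y => E y * p k y) k x).
Proof.
move=> Wx0; have [r hr] := hX; have [N [Y [cY rfY]]] := hr _ Wx0.
pose f := fullrankfun rfY.
have dY i : smooth_field W (Y i) /\ forall g, smooth_on W g -> dominated (formal_adjoint (Y i) g).
  by have [l _ cl] := cY i; exact: (dominated_commutator oW sX oO OW cl).
pose B x := \matrix_(i < n) Y (f i) x.
pose D x := \det (B x).
have sB i j : smooth_on W (fun x => B x i j).
  by under eq_fun do rewrite mxE; exact: (dY (f i)).1.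
have sD : smooth_on W D by exact: smooth_on_det.
have Dx0 : D x0 != 0.
  have : rowsub f (\matrix_(i < N) Y i x0) \in unitmx by exact: fullrowsub_unit.
  rewrite unitmxE unitfE; suff -> : rowsub f (\matrix_i Y i x0) = B x0 by [].
  by apply/matrixP => i j; rewrite !mxE.
(* One factor [D] comes from [\adj (B x) *m B x], the other is put into [b]: the square is positive
   at [x0] whatever the sign of the determinant. The adjugate keeps everything smooth on [W], even
   where [D] vanishes. *)
exists (fun x => D x * D x); first by split; [exact: smooth_onM|rewrite -expr2 exprn_even_gt0].
move=> p sp.
pose b i x := \sum_j D x * p j x * (\adj (B x)) j i.
have sb i : smooth_on W (b i).
  apply: smooth_on_sum => // j _; apply: smooth_onM => //; first exact: smooth_onM.
  exact: smooth_on_adj.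
have sYb i k : smooth_on W (fun y => Y (f i) y ord0 k * b i y).
  by apply: smooth_onM => //; exact: (dY (f i)).1.
have bE y k : \sum_i Y (f i) y ord0 k * b i y = D y * D y * p k y.
  under eq_bigr do rewrite mulr_sumr; rewrite exchange_big/=.
  transitivity (\sum_j D y * p j y * (\adj (B y) *m B y) j k).
    apply: eq_bigr => j _; rewrite mxE mulr_sumr; apply: eq_bigr => i _.
    by rewrite [B y i k]mxE; ring.
  rewrite mul_adj_mx (bigD1 k)//= big1 ?addr0; first by rewrite mxE eqxx mulr1n /D; ring.
  by move=> j jk; rewrite mxE (negbTE jk) mulr0n mulr0.
apply: (dominated_le (psi' := fun x => \sum_i formal_adjoint (Y (f i)) (b i) x)).
- apply: weightable_smooth => //; apply: smooth_on_subset (Omega_subW OW) _.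
  apply: smooth_onN => //; apply: smooth_on_sum => // k _; apply: smooth_on_partial.
  by apply: smooth_onM => //; exact: smooth_onM.
- by apply: dominated_sum => i; exact: (dY (f i)).2.
- move=> x /(Omega_subW OW) Wx; rewrite /formal_adjoint sumrN exchange_big/= lerN2.
  rewrite le_eqVlt; apply/orP; left; apply/eqP; apply: eq_bigr => k _.
  have sYbk i : true -> smooth_on W (fun y => Y (f i) y ord0 k * b i y) by [].
  rewrite -(partial_sum _ k oW sYbk Wx).
  suff -> : (fun y => \sum_i Y (f i) y ord0 k * b i y) = (fun y => D y * D y * p k y) by [].
  by apply/funext => y; exact: bE.
Qed.

End propagation.

(** * Divergence of a radial bump field *)

Section bump_divergence.
Context {R : realType} {n : nat}.
Variables (W : set 'rV[R]_n) (oW : open W).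
Implicit Types (x y z : 'rV[R]_n).

(** Euclidean, hence smooth, unlike the sup norm that defines [ball] on row vectors; [sqdist_coord]
    passes from one to the other. *)
Definition sqdist y x : R := \sum_i (x ord0 i - y ord0 i) ^+ 2.

Lemma sqdist_ge0 y x : 0 <= sqdist y x.
Proof. by apply: sumr_ge0 => i _; exact: sqr_ge0. Qed.

Lemma sqdist_coord y x (r : R) i : 0 <= r -> sqdist y x < r ^+ 2 ->
  `|x ord0 i - y ord0 i| < r.
Proof.
move=> r0 yx; rewrite -(@ltr_pXn2r _ 2)// ?nnegrE// real_normK ?num_real//.
apply: le_lt_trans yx; rewrite /sqdist (bigD1 i)//= lerDl.
by apply: sumr_ge0 => j _; exact: sqr_ge0.
Qed.

Lemma smooth_sqdist y : smooth_on W (sqdist y).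
Proof.
apply: smooth_on_sum => // i _; under eq_fun do rewrite expr2.
by apply: smooth_onM => //; apply: smooth_onB => //;
  [exact: smooth_on_coord|exact: smooth_on_cst|exact: smooth_on_coord|exact: smooth_on_cst].
Qed.

Lemma partial_coordB y k i x :
  partial (fun z : 'rV[R]_n => z ord0 i - y ord0 i) k x = (k == i)%:R.
Proof.
rewrite (@partialB _ _ setT _ (cst (y ord0 i)) k x (smooth_on_coord setT i) (smooth_on_cst _ _) I).
by rewrite partial_cst subr0 partial_coord.
Qed.

Lemma smooth_coordB A y i : open A -> smooth_on A (fun z : 'rV[R]_n => z ord0 i - y ord0 i).
Proof.
by move=> oA; apply: smooth_onB => //; [exact: smooth_on_coord|exact: smooth_on_cst].
Qed.

Lemma partial_sqdist y k x : partial (sqdist y) k x = 2 * (x ord0 k - y ord0 k).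
Proof.
have sc i : smooth_on setT (fun z : 'rV[R]_n => z ord0 i - y ord0 i).
  by apply: smooth_coordB; exact: openT.
rewrite /sqdist.
have -> : (fun x => \sum_i (x ord0 i - y ord0 i) ^+ 2) =
    (fun x => \sum_i (x ord0 i - y ord0 i) * (x ord0 i - y ord0 i)).
  by apply/funext => z; apply: eq_bigr => i _; rewrite expr2.
have sc2 i : true -> smooth_on setT (fun z : 'rV[R]_n => (z ord0 i - y ord0 i) * (z ord0 i - y ord0 i)).
  by move=> _; apply: smooth_onM => //; exact: openT.
rewrite (partial_sum _ k openT sc2 I) (bigD1 k)//= big1 => [|i ik].
  by rewrite (partialM k (sc k) (sc k) I) partial_coordB eqxx/=; ring.
by rewrite (partialM k (sc i) (sc i) I) partial_coordB eq_sym (negbTE ik)/=; ring.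
Qed.

Section bump.
Variables (E : 'rV[R]_n -> R) (sE : smooth_on W E).
Variables (y : 'rV[R]_n) (r c : R).

Let q x := c * (r ^+ 2 - sqdist y x).
Let h x := flat 0 (q x).
Let p k x := (x ord0 k - y ord0 k) * h x.

Let smooth_q : smooth_on W q.
Proof.
apply: smooth_onZ => //; apply: smooth_onB => //; first exact: smooth_on_cst.
exact: smooth_sqdist.
Qed.

Lemma smooth_bump : smooth_on W h.
Proof. exact: smooth_on_flat. Qed.

Lemma smooth_bump_field k : smooth_on W (p k).
Proof. by apply: smooth_onM => //; [exact: smooth_coordB|exact: smooth_bump]. Qed.

Let partial_q k x : W x -> partial q k x = - (2 * c * (x ord0 k - y ord0 k)).
Proof.
move=> Wx; have s1 : smooth_on W (fun x => r ^+ 2 - sqdist y x).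
  by apply: smooth_onB => //; [exact: smooth_on_cst|exact: smooth_sqdist].
rewrite (partialZ c k s1 Wx).
rewrite (partialB k (smooth_on_cst W (r ^+ 2)) (smooth_sqdist y) Wx).
by rewrite partial_cst partial_sqdist; ring.
Qed.

Let partial_h k x : W x ->
  partial h k x = - (2 * c * (x ord0 k - y ord0 k) * flat 2 (q x)).
Proof.
move=> Wx; have dq := derivableP (@smooth_on_derivable _ _ W q x k smooth_q Wx).
have [_] := is_derive_flat_comp 0 dq; rewrite -/(partial q k x) -/(partial h k x) => ->.
by rewrite partial_q//; ring.
Qed.

(** The first term comes from differentiating the profile [h]. Where [0 < q x] it equals [2 * c * E
    x * sqdist y x * h x / q x ^+ 2], and as [q x] is at most [c * r ^+ 2], it grows like [h x / c]
    for small [c] away from [y]. The remaining terms are bounded by a multiple of [h x] that does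
    not involve [c]. *)
Lemma divergence_bump x : W x ->
  - \sum_k partial (fun z => E z * p k z) k x =
  2 * c * E x * sqdist y x * flat 2 (q x) -
  h x * (\sum_k partial E k x * (x ord0 k - y ord0 k) + n%:R * E x).
Proof.
move=> Wx.
have pk k : partial (fun z => E z * p k z) k x =
    partial E k x * (x ord0 k - y ord0 k) * h x + E x * h x
    - 2 * c * E x * flat 2 (q x) * (x ord0 k - y ord0 k) ^+ 2.
  have sc := @smooth_coordB W y k oW.
  rewrite (partialM k sE (smooth_bump_field k) Wx).
  rewrite (partialM k sc smooth_bump Wx) partial_coordB eqxx partial_h//=.
  by rewrite /p; ring.
under eq_bigr do rewrite pk.
rewrite !big_split/= sumrN -!mulr_suml -mulr_sumr -/(sqdist y x) sumr_const card_ord.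
by rewrite -mulr_natl; ring.
Qed.

End bump.

End bump_divergence.

(** * Propagation of domination through [W] and the inequality for test functions *)

Section poincare_test_functions.
Context {R : realType} {n m : nat}.
Variables (X : 'I_m -> 'rV[R]_n -> 'rV[R]_n) (W Omega : set 'rV[R]_n).
Hypotheses (oW : open W) (sX : forall j, smooth_field W (X j)).
Hypotheses (oO : open Omega) (OW : compactly_included Omega W).
Hypothesis hX : hormander_condition X W.
Local Notation mu := (lebesgue_rV n).
Local Notation dominated := (dominated X Omega).
Local Notation weightable := (@weightable R n Omega).

Definition dominated_at x := exists V, [/\ open V, V x & dominated (\1_V)].

(** [rho] is fixed before [y]. The neighbourhood on which domination is known at [y] may be
    arbitrarily small; its size enters only through the steepness [c] of the bump, not through the
    radius. *)
Lemma dominated_near (x0 : 'rV[R]_n) : W x0 -> exists2 rho : R, 0 < rho &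
  forall y, ball x0 rho y -> dominated_at y -> dominated_at x0.
Proof.
move=> Wx0; have [E [sE E0] dE] := dominated_divergence oW sX oO OW hX Wx0.
pose d := E x0 / 2; have d0 : 0 < d by rewrite divr_gt0.
have nE : \forall x \near x0, d <= E x <= 2 * E x0 /\
    forall k, `|partial E k x| <= `|partial E k x0| + 1.
  have cE := smooth_on_continuous sE Wx0.
  have cdE k := smooth_on_continuous (smooth_on_partial k sE) Wx0.
  have nE1 : \forall x \near x0, d <= E x <= 2 * E x0.
    have /cvgrPdist_le/(_ d d0) := cE; apply: filterS => x; rewrite ler_norml /d.
    by move=> /andP[h1 h2]; apply/andP; split; lra.
  have nE2 : \forall x \near x0, forall k, `|partial E k x| <= `|partial E k x0| + 1.
    apply: (@filter_forall _ _ (fun k x => `|partial E k x| <= `|partial E k x0| + 1) (nbhs x0)) => k.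
    have /cvgrPdist_le/(_ 1 ltr01) := cdE k.
    apply: filterS => x dx; rewrite -[X in `|X|](subrKC (partial E k x0)).
    by rewrite (le_trans (ler_normD _ _))// lerD2l distrC.
  exact: filterI nE1 nE2.
have /nbhs_ballP[/= rho0 rho00 rhoE] : nbhs x0 (W `&` [set x | d <= E x <= 2 * E x0 /\
    forall k, `|partial E k x| <= `|partial E k x0| + 1]).
  by apply: (@filterI _ (nbhs x0)); [exact: near_open|exact: nE].
pose r := rho0 / 2; have r0 : 0 < r by rewrite divr_gt0.
(* Bounds the factor of [h x] in [divergence_bump] wherever [sqdist y x < r ^+ 2]. *)
pose L := \sum_k (`|partial E k x0| + 1) * r + n%:R * (2 * E x0).
have L0 : 0 <= L.
  rewrite addr_ge0//; last by rewrite mulr_ge0// mulr_ge0// ltW.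
  by apply: sumr_ge0 => k _; rewrite mulr_ge0 ?addr_ge0// ltW.
(* From sup norm to Euclidean norm: [n * rho ^+ 2 < r ^+ 2], so the Euclidean ball of radius [r]
   about [y] contains [x0]. As [r] is half of [rho0], that ball stays where [E] is controlled. *)
pose rho := r / n.+1%:R; have rho_gt0 : 0 < rho by rewrite divr_gt0.
exists rho => // y x0y [U [oU Uy dU]].
have y0 : sqdist y x0 < r ^+ 2.
  apply: (@le_lt_trans _ _ (\sum_(i < n) rho ^+ 2)).
    apply: ler_sum => i _; rewrite -real_normK ?num_real// lerXn2r ?nnegrE//; first exact: ltW.
    by have /(_ i)/ltW := (ball_rVP x0 y rho_gt0).1 x0y.
  rewrite sumr_const card_ord -mulr_natl /rho expr_div_n mulrCA gtr_pMr ?exprn_gt0//.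
  by rewrite ltr_pdivrMr ?exprn_gt0// mul1r -natrX ltr_nat (@leq_trans (n.+1 ^ 1))// leq_pexp2l.
have inball x : sqdist y x < r ^+ 2 -> ball x0 rho0 x.
  move=> yx; apply/ball_rVP => // i.
  have h1 := sqdist_coord i (ltW r0) yx.
  have h2 : `|x0 ord0 i - y ord0 i| < r.
    have /(_ i)/lt_le_trans := (ball_rVP x0 y rho_gt0).1 x0y; apply.
    by rewrite ler_pdivrMr// ler_peMr ?ler1n//; exact: ltW.
  rewrite -(subrKA (y ord0 i)) (le_lt_trans (ler_normD _ _))//.
  by rewrite [rho0](splitr rho0) ltrD// distrC.
have /nbhs_ballP[/= s s0 sU] := near_open oU Uy.
pose delta := s ^+ 2; have delta0 : 0 < delta by rewrite exprn_gt0.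
have deltaU x : sqdist y x < delta -> U x.
  move=> yx; apply: sU; apply/ball_rVP => // i; rewrite distrC.
  exact: sqdist_coord (ltW s0) yx.
(* Solves [2 * c * d * delta / (c * r ^+ 2) ^+ 2 = L + 1]: at squared distance at least [delta] from
   [y], the gain is then at least [h x * (L + 1)]. *)
pose c := 2 * d * delta / (r ^+ 4 * (L + 1)).
have L1 : 0 < L + 1 by rewrite ltr_wpDl.
have c0 : 0 < c by rewrite divr_gt0 ?mulr_gt0 ?exprn_gt0.
pose q x := c * (r ^+ 2 - sqdist y x); pose h x := flat 0 (q x).
pose p (k : 'I_n) (x : 'rV[R]_n) := (x ord0 k - y ord0 k) * h x.
have sp k : smooth_on W (p k) by exact: smooth_bump_field.
have := dE p sp; set F := fun x => - _ => dF.
have U0 x : 0 <= (L + 1) * \1_U x.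
  by apply: mulr_ge0; [exact: ltW|rewrite indicE].
(* Outside the bump both [h] and [F] vanish. Near [y] the gain is nonnegative and [h <= 1], so
   [F >= - L] and the indicator compensates. Elsewhere the gain beats the loss [h x * L] by at least
   [h x]. *)
have FE x : W x -> h x <= F x + (L + 1) * \1_U x.
  move=> Wx; rewrite /F (divergence_bump oW sE y r c Wx) -/(q x) -/(h x).
  have [q0|q0] := lerP (q x) 0.
    by rewrite /h !flat_eq0// !mulr0 mul0r subr0 add0r U0.
  have yx : sqdist y x < r ^+ 2 by move: q0; rewrite /q pmulr_rgt0// subr_gt0.
  have [_ [/andP[dEx Ex2] dEk]] := rhoE _ (inball _ yx).
  have h0 : 0 <= h x by exact: flat_ge0.
  have hL : h x * (\sum_k partial E k x * (x ord0 k - y ord0 k) + n%:R * E x) <= h x * L.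
    rewrite ler_wpM2l// lerD ?ler_wpM2l//; apply: ler_sum => k _.
    rewrite (le_trans (ler_norm _))// normrM ler_pM//.
    exact/ltW/(sqdist_coord k (ltW r0) yx).
  have Ex0 : 0 <= E x := le_trans (ltW d0) dEx.
  have c00 := ltW c0.
  have fl : 0 <= flat 2 (q x) by exact: flat_ge0.
  have sq := sqdist_ge0 y x.
  have [yd|yd] := ltrP (sqdist y x) delta.
    have -> : \1_U x = 1 :> R by rewrite indicE mem_set//; exact: deltaU.
    have hle1 : h x <= 1 by exact: flat0_le1.
    have t0 : 0 <= 2 * c * E x * sqdist y x * flat 2 (q x).
      exact: (mulr_ge0 (mulr_ge0 (mulr_ge0 (mulr_ge0 (ler0n _ 2) c00) Ex0) sq) fl).
    have hL' : h x * L <= L by rewrite ler_piMl.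
    rewrite mulr1; lra.
  suff : h x * (L + 1) <= 2 * c * E x * sqdist y x * flat 2 (q x) by move: (U0 x); rewrite mulrDr mulr1; lra.
  have qr : q x <= c * r ^+ 2 by rewrite /q ler_pM2l// gerBl.
  have flE : flat 2 (q x) = h x / q x ^+ 2.
    by rewrite /h !flatS expr2 (invfM (q x) (q x)) mulrA mulrC.
  have : h x / (c * r ^+ 2) ^+ 2 <= flat 2 (q x).
    have cr0 : 0 < c * r ^+ 2 by rewrite mulr_gt0// exprn_gt0.
    rewrite flE ler_wpM2l// lef_pV2 ?posrE ?exprn_gt0//.
    by rewrite lerXn2r ?nnegrE//; exact: ltW.
  have dd : 2 * c * d * delta <= 2 * c * E x * sqdist y x.
    apply: ler_pM => //; [|exact: ltW|exact: (ler_wpM2l (mulr_ge0 (ler0n _ 2) c00) dEx)].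
    exact: (mulr_ge0 (mulr_ge0 (ler0n _ 2) c00) (ltW d0)).
  have cdd := mulr_ge0 (mulr_ge0 (mulr_ge0 (ler0n _ 2) c00) (ltW d0)) (ltW delta0).
  have hc0 : 0 <= h x / (c * r ^+ 2) ^+ 2 by rewrite divr_ge0 ?sqr_ge0.
  move=> hfl; apply: (le_trans _ (ler_pM cdd hc0 dd hfl)).
  rewrite le_eqVlt; apply/orP; left; apply/eqP; rewrite /c.
  by field; rewrite ?gt_eqF//.
have hx0 : 0 < h x0 by apply: flat_gt0; rewrite /q mulr_gt0// subr_gt0.
pose V := [set x | h x0 / 2 < h x]°.
have Vx0 : V x0.
  have ch : {for x0, continuous h} by exact: smooth_on_continuous (smooth_bump oW y r c) Wx0.
  apply: (ch [set t | h x0 / 2 < t]); apply: lt_nbhsr; lra.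
exists V; split=> //; first exact: open_interior.
have dsum : dominated (fun x => (2 / h x0) * (F x + (L + 1) * \1_U x)).
  apply: dominatedZ; first by rewrite divr_ge0// ltW.
  by apply: dominatedD => //; apply: dominatedZ => //; exact: ltW.
apply: (dominated_le _ dsum); first by apply: weightable_indic => //; exact: open_interior.
move=> x /(Omega_subW OW) Wx; rewrite -(@ler_pM2l _ (h x0 / 2)) ?divr_gt0//.
rewrite mulrA (_ : h x0 / 2 * (2 / h x0) = 1); last by field; rewrite gt_eqF.
rewrite mul1r; apply: le_trans (FE x Wx); rewrite indicE.
have [xV|xV] := pselect (V x); last by rewrite memNset// mulr0 flat_ge0.
by rewrite mem_set// mulr1; apply: ltW; exact: interior_subset xV.
Qed.

(** Otherwise [W] would be nonempty, open and compact: a coordinate would attain its maximum over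
    [W] at a point around which [W] still contains larger values. *)
Lemma exists_exterior_point : (0 < n)%N -> W !=set0 ->
  exists2 x, W x & ~ closure Omega x.
Proof.
move=> n0 [w Ww]; apply: contrapT => H.
have WE : W = closure Omega.
  apply/seteqP; split; last exact: OW.2.
  by move=> x Wx; apply: contrapT => Ox; apply: H; exists x.
pose k := Ordinal n0.
have cW : compact W by rewrite WE; exact: OW.1.
have ck : {within W, continuous (fun x : 'rV[R]_n => x ord0 k)}.
  by apply: continuous_subspaceT; exact: coord_continuous.
have [z zW zmax] := compact_EVT_max (ex_intro _ w Ww) cW ck.
move: zW; rewrite inE => Wz.
have /nbhs_ballP[/= r r0 rW] := near_open oW Wz.
pose z' := z + (r / 2) *: base_vec k.
have /zmax : z' \in W.
  rewrite inE; apply: rW; apply/ball_rVP => // i.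
  rewrite /z' !mxE opprD addNKr normrN normrM gtr0_norm ?divr_gt0//.
  by case: (i == k); rewrite ?eqxx/= ?normr1 ?normr0 ?mulr1 ?mulr0// ltr_pdivrMr// ltr_pMr// ltr1n.
by rewrite /z' !mxE !eqxx mulr1 gerDl leNgt divr_gt0.
Qed.

Lemma dominated_indic_Omega : (0 < n)%N -> W !=set0 -> connected W -> dominated (\1_Omega).
Proof.
move=> n0 W0 cW.
have allW : W `&` dominated_at = W.
  apply: cW.
  - have [x Wx Ox] := exists_exterior_point n0 W0; exists x; split => //.
    exists (~` closure Omega); split => //; first exact: open_setC_closure.
    (* The indicator of the exterior is zero on [Omega], so the zero weight majorizes it there. *)
    apply: (dominated_le _ (dominated0 X oO)).
      by apply: weightable_indic => //; exact: open_setC_closure.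
    by move=> y Oy; rewrite indicE memNset// => /(_ (subset_closure Oy)).
  - exists dominated_at => //; rewrite openE => x [V [oV Vx dV]].
    by apply: filterS (near_open oV Vx) => y Vy; exists V.
  - exists (closure dominated_at); first exact: closed_closure.
    apply/seteqP; split=> x [Wx]; first by split => //; exact: subset_closure.
    move=> clx; split=> //; have [rho rho0 rhoP] := dominated_near Wx.
    have [y [dy xy]] := clx _ (nbhsx_ballx x rho rho0).
    exact: rhoP xy dy.
have cover_ex x : exists V, W x -> [/\ open V, V x & dominated (\1_V)].
  have [Wx|nWx] := pselect (W x); last by exists set0.
  by move: Wx; rewrite -allW => -[Wx [V VP]]; exists V.
have [V VP] := choice cover_ex.
have cO := OW.1; rewrite compact_cover in cO.
have [|x Ox|D DW OD] := cO _ W V.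
- by move=> x /VP[].
- by have Wx := OW.2 _ Ox; exists x => //; have [] := VP _ Wx.
have dD (s : seq 'rV[R]_n) : {subset s <= W} -> dominated (fun x => \sum_(i <- s) \1_(V i) x).
  elim: s => [_|i s IH sW].
    by under eq_fun do rewrite big_nil; exact: dominated0.
  under eq_fun do rewrite big_cons; apply: dominatedD => //.
    by have := sW i (mem_head _ _); rewrite inE => /VP[].
  by apply: IH => j js; apply: sW; rewrite in_cons js orbT.
apply: (dominated_le (weightable_indic oO oO) (dD (finmap.enum_fset D) DW)).
move=> x Ox; have [i /= iD Vx] := OD _ (subset_closure Ox).
rewrite (big_rem i)//= [leLHS]indicE [X in _ <= X + _]indicE !mem_set// lerDl.
by apply: sumr_ge0 => j _; rewrite indicE.
Qed.

Lemma poincare_test_function : (0 < n)%N -> W !=set0 -> connected W ->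
  exists2 C : R, 0 < C & forall phi, test_function Omega phi ->
    \int[mu]_x (phi x ^+ 2) <= C * \int[mu]_x test_sqgrad X phi x.
Proof.
move=> n0 W0 cW; have [w dO] := dominated_indic_Omega n0 W0 cW.
have [|C C0 hC] := dO (1 / 2); first by rewrite divr_gt0.
(* Half of the mass is absorbed on the left, which doubles [C]; the 1 makes the constant positive
   even if [C = 0]. *)
exists (2 * C + 1) => [|phi tp]; first by rewrite ltr_wpDl// mulr_ge0.
have := hC _ tp.
have -> : \int[mu]_x (\1_Omega x * phi x ^+ 2) = \int[mu]_x (phi x ^+ 2).
  apply: eq_Rintegral => x _; rewrite indicE.
  have [Ox|Ox] := pselect (Omega x); first by rewrite mem_set// mul1r.
  by rewrite (test_function_eq0 tp Ox) expr0n mulr0.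
have : 0 <= \int[mu]_x test_sqgrad X phi x.
  by apply: Rintegral_ge0 => x _; exact: test_sqgrad_ge0.
lra.
Qed.

End poincare_test_functions.

(** * Uniqueness of weak derivatives *)

Section box_bumps.
Context {R : realType} {n : nat}.
Implicit Types (a b : 'rV[R]_n) (W : set 'rV[R]_n).
Local Notation mu := (lebesgue_rV n).

(** Takes values between 0 and 1 and tends pointwise to the indicator of the open box as [N] grows;
    [N.+1] keeps the scaling positive. *)
Definition box_bump a b (N : nat) (x : 'rV[R]_n) : R :=
  \prod_i (flat 0 (N.+1%:R * (x ord0 i - a ord0 i)) *
           flat 0 (N.+1%:R * (b ord0 i - x ord0 i))).

Lemma box_bump_ge0 a b N x : 0 <= box_bump a b N x.
Proof. by apply: prodr_ge0 => i _; rewrite mulr_ge0 ?flat_ge0. Qed.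

Lemma box_bump_le1 a b N x : box_bump a b N x <= 1.
Proof.
have E1 : \prod_(i < n) (1 : R) = 1 by rewrite big1_eq.
rewrite /box_bump -[leRHS]E1; apply: ler_prod => i _.
rewrite mulr_ge0 ?flat_ge0//= -[leRHS]mulr1.
by rewrite ler_pM ?flat_ge0 ?flat0_le1.
Qed.

Lemma box_bump_eq0 a b N x : ~ obox a b x -> box_bump a b N x = 0.
Proof.
move=> /existsNP[i abi]; rewrite /box_bump (bigD1 i)//=.
have [ax|ax] := leP (x ord0 i) (a ord0 i).
  by rewrite flat_eq0 ?mul0r// pmulr_rle0// subr_le0.
have [xb|xb] := leP (b ord0 i) (x ord0 i).
  by rewrite [X in _ * X * _]flat_eq0 ?mulr0 ?mul0r// pmulr_rle0// subr_le0.
by exfalso; apply: abi; rewrite ax xb.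
Qed.

Lemma box_bump_gt0 a b N x : obox a b x -> 0 < box_bump a b N x.
Proof.
move=> abx; apply: prodr_gt0 => i _; have /andP[ax xb] := abx i.
by rewrite mulr_gt0// flat_gt0// mulr_gt0// subr_gt0.
Qed.

Lemma smooth_box_bump a b N : smooth_on setT (box_bump a b N).
Proof.
have oT := @openT 'rV[R]_n; apply: smooth_on_prod => // i _.
by apply: smooth_onM => //; apply: smooth_on_flat => //; apply: smooth_onZ => //;
  apply: smooth_onB => //; (exact: smooth_on_coord || exact: smooth_on_cst).
Qed.

Lemma closed_cbox a b : closed (cbox a b).
Proof.
rewrite (_ : cbox a b = \bigcap_(i in [set: 'I_n])
    ((fun v : 'rV[R]_n => v ord0 i) @^-1` `[a ord0 i, b ord0 i])); last first.
  by apply/seteqP; split => v /= Bv i => [_|]; exact: Bv.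
apply: closed_bigI => i _; apply: preimage_closed; last exact: interval_closed.
by move=> x _; exact: coord_continuous.
Qed.

Lemma compact_cbox_set a b : compact (cbox a b).
Proof.
apply: bounded_closed_compact; last exact: closed_cbox.
exists (`|a| + `|b|); split; first exact: num_real.
move=> M ltM x xab; apply: le_trans (ltW ltM).
rewrite [leLHS]/Num.Def.normr/= mx_normrE; apply: bigmax_le; first by rewrite addr_ge0.
move=> [i j] _ /=; rewrite ord1.
have ja : `|a ord0 j| <= `|a|.
  rewrite [leRHS]/Num.Def.normr/= mx_normrE.
  exact: (le_bigmax _ (fun ij => `|a ij.1 ij.2|) (ord0, j)).
have jb : `|b ord0 j| <= `|b|.
  rewrite [leRHS]/Num.Def.normr/= mx_normrE.
  exact: (le_bigmax _ (fun ij => `|b ij.1 ij.2|) (ord0, j)).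
have := xab j; rewrite in_itv/= => /andP[h1 h2].
have := ja; have := jb; rewrite !ler_norml => /andP[h5 h6] /andP[h3 h4].
have := normr_ge0 a; have := normr_ge0 b.
by move=> b0 a0; apply/andP; split; lra.
Qed.

Lemma test_function_box_bump a b N W : cbox a b `<=` W -> test_function W (box_bump a b N).
Proof.
move=> abW; have S : closure [set x | box_bump a b N x != 0] `<=` cbox a b.
  rewrite [X in _ `<=` X](closure_id _).1; last exact: closed_cbox.
  apply: closureS => x; apply: contra_neqP => abx; apply: box_bump_eq0.
  by apply: contra_not abx => h i; have /andP[? ?] := h i; rewrite in_itv/= !ltW.
split; first exact: smooth_box_bump.
  by apply: subclosed_compact S; [exact: closed_closure|exact: compact_cbox_set].
exact: subset_trans abW.
Qed.

Lemma flat0_cvg1 (t : R) : 0 < t -> flat 0 (N.+1%:R * t) @[N --> \oo] --> (1 : R).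
Proof.
move=> t0; have -> : (fun N => flat 0 (N.+1%:R * t)) = (fun N => expR (- (N.+1%:R^-1 * t^-1))).
  by apply/funext => N; rewrite /flat mulr_gt0// expr0 mul1r invfM.
rewrite -[X in _ --> X](@expR0 R); apply: continuous_cvg; first exact: continuous_expR.
rewrite -[X in _ --> X]oppr0; apply: cvgN; rewrite -[X in _ --> X](mul0r t^-1).
by apply: cvgMr_tmp; exact: cvg_harmonic.
Qed.

Lemma box_bump_cvg a b x : obox a b x -> box_bump a b N x @[N --> \oo] --> (1 : R).
Proof.
move=> abx; have E1 : \prod_(i < n) (1 : R) = 1 by rewrite big1_eq.
rewrite -[X in _ --> X]E1.
apply: cvg_big => [|i _]; first exact: mul_continuous.
have /andP[ax xb] := abx i; rewrite -[X in _ --> X]mulr1.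
by apply: cvgM; apply: flat0_cvg1; rewrite subr_gt0.
Qed.

End box_bumps.

(** * A generating pi-system for the product sigma-algebra *)

Section rV_generation.
Context {R : realType} {n : nat}.

(** Strict orthants are chosen because an open box meets one in another open box with the same lower
    corner, so integrals over boxes settle this pi-system. *)
Definition lower_sets : set (set 'rV[R]_n) :=
  [set S | exists c : 'rV[R]_n, S = [set v : 'rV[R]_n | forall i, v ord0 i < c ord0 i]].

Lemma setI_closed_lower_sets : setI_closed lower_sets.
Proof.
move=> _ _ [c ->] [d ->]; exists (\row_i Num.min (c ord0 i) (d ord0 i)).
apply/seteqP; split=> v /=.
  by move=> [vc vd] i; rewrite mxE lt_min vc vd.
by move=> h; split => i; have := h i; rewrite mxE lt_min => /andP[].
Qed.

Lemma measurable_lower_sets : @measurable _ 'rV[R]_n = <<s lower_sets >>.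
Proof.
apply/seteqP; split; last first.
  apply: smallest_sub; first exact: sigma_algebra_measurable.
  move=> _ [c ->].
  rewrite (_ : [set v | _] = \bigcap_(i : 'I_n)
      ((fun v : 'rV[R]_n => v ord0 i) @^-1` `]-oo, c ord0 i[)); last first.
    by apply/seteqP; split => v /= Bv i => [_|]; have := Bv i; rewrite /= in_itv/=//; exact.
  apply: fin_bigcap_measurable => // i _.
  by rewrite -[X in measurable X]setTI; exact: measurable_coor.
have mc (i : 'I_n) : measurable_fun [set: g_sigma_algebraType lower_sets]
    (fun v : 'rV[R]_n => v ord0 i : R).
  apply: (measurability _ (RGenInftyO.measurableE R)) => //.
  move=> _ [_ [c ->] <-]; rewrite setTI.
  (* A half-space is a countable union of orthants whose other bounds go to infinity. *)
  rewrite (_ : _ @^-1` _ = \bigcup_N [set v : 'rV[R]_n |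
      forall j, v ord0 j < (\row_j (if j == i then c else N%:R)) ord0 j]); last first.
    apply/seteqP; split=> v; rewrite /= in_itv/=.
      move=> vc; exists (Num.truncn `|v|).+1 => // j /=; rewrite mxE.
      case: eqP => [->//|_]; apply: le_lt_trans (truncnS_gt _).
      rewrite (le_trans (ler_norm _))// [leRHS]/Num.Def.normr/= mx_normrE.
      exact: (le_bigmax _ (fun ij => `|v ij.1 ij.2|) (ord0, j)).
    by move=> [N _ /(_ i)] /=; rewrite mxE eqxx.
  by apply: bigcupT_measurable => N; apply: sub_sigma_algebra; eexists.
apply: smallest_sub; first exact: smallest_sigma_algebra.
rewrite -bigcup_seq => A [i _ [B mB <-]]; exact: mc.
Qed.

End rV_generation.

(** * Square-integrable functions and the fundamental lemma of the calculus of variations *)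

Section square_integrable.
Context {R : realType} {n : nat}.
Implicit Types (A B D W : set 'rV[R]_n) (f g u v : 'rV[R]_n -> R).
Local Notation mu := (lebesgue_rV n).

Lemma L2P A f : measurable A ->
  L2 A f <-> measurable_fun A f /\ mu.-integrable A (EFin \o (fun x => f x ^+ 2)).
Proof.
move=> mA; have E : (\int[mu]_(x in A) (`|f x| ^+ 2)%:E =
    \int[mu]_(x in A) `|(f x ^+ 2)%:E|)%E.
  by apply: eq_integral => x _; rewrite /= real_normK ?num_real// ger0_norm ?sqr_ge0.
split=> [[mf foo]|[mf /integrableP[_ foo]]]; split => //.
  apply/integrableP; split; last by rewrite -E.
  by apply/measurable_EFinP; exact: measurable_funX.
by rewrite E.
Qed.

Lemma L2_integrable_sqr A f : measurable A -> L2 A f ->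
  mu.-integrable A (EFin \o (fun x => f x ^+ 2)).
Proof. by move=> mA /(L2P _ mA)[]. Qed.

Lemma integrable_le A f g : measurable A -> measurable_fun A f ->
  mu.-integrable A (EFin \o g) -> (forall x, A x -> `|f x| <= g x) ->
  mu.-integrable A (EFin \o f).
Proof.
move=> mA mf gi fg; apply: (le_integrable mA _ _ gi); first exact/measurable_EFinP.
by move=> x Ax; rewrite /= lee_fin (le_trans (fg _ Ax))// ler_norm.
Qed.

Lemma integrable_lin A f g (c d : R) : measurable A ->
  mu.-integrable A (EFin \o f) -> mu.-integrable A (EFin \o g) ->
  mu.-integrable A (EFin \o (fun x => c * f x + d * g x)).
Proof. by move=> mA fi gi; exact: (integrableD mA (integrableZl mA c fi) (integrableZl mA d gi)). Qed.

Lemma Rintegral_lin A f g (c d : R) : measurable A ->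
  mu.-integrable A (EFin \o f) -> mu.-integrable A (EFin \o g) ->
  \int[mu]_(x in A) (c * f x + d * g x) =
  c * \int[mu]_(x in A) f x + d * \int[mu]_(x in A) g x.
Proof.
move=> mA fi gi; rewrite RintegralD//; last 2 first.
- exact: (integrableZl mA c fi).
- exact: (integrableZl mA d gi).
by rewrite !RintegralZl.
Qed.

Lemma L2_lin A f g (c d : R) : measurable A -> L2 A f -> L2 A g ->
  L2 A (fun x => c * f x + d * g x).
Proof.
move=> mA /(L2P _ mA)[mf fi] /(L2P _ mA)[mg gi]; apply/(L2P _ mA).
have mfg : measurable_fun A (fun x => c * f x + d * g x).
  by apply: measurable_funD; apply: measurable_funM.
split=> //; apply: (@integrable_le A _ (fun x => 2 * c ^+ 2 * f x ^+ 2 + 2 * d ^+ 2 * g x ^+ 2)) => //.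
- exact: measurable_funX.
- exact: integrable_lin.
- move=> x _; rewrite ger0_norm ?sqr_ge0// -subr_ge0.
  rewrite (_ : _ - _ = (c * f x - d * g x) ^+ 2) ?sqr_ge0//; ring.
Qed.

Lemma L2M_integrable A f g : measurable A -> L2 A f -> L2 A g ->
  mu.-integrable A (EFin \o (fun x => f x * g x)).
Proof.
move=> mA /(L2P _ mA)[mf fi] /(L2P _ mA)[mg gi].
apply: (@integrable_le A _ (fun x => 1 * f x ^+ 2 + 1 * g x ^+ 2)) => //.
- exact: measurable_funM.
- exact: integrable_lin.
- move=> x _; rewrite normrM !mul1r -(real_normK (num_real (f x))) -(real_normK (num_real (g x))).
  have := sqr_ge0 (`|f x| - `|g x|); have := sqr_ge0 (`|f x| + `|g x|); nra.
Qed.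

Lemma L2_subset A B f : measurable A -> measurable B -> B `<=` A -> L2 A f -> L2 B f.
Proof.
move=> mA mB BA /(L2P _ mA)[mf fi]; apply/(L2P _ mB); split.
  exact: measurable_funS mf.
exact: integrableS fi.
Qed.

Lemma test_function_L2 A B f : open B -> measurable A -> test_function B f -> L2 A f.
Proof.
move=> oB mA tf; apply/(L2P _ mA); split; first exact: test_function_measurable tf.
by apply: (@test_function_integrable _ _ B) => //; exact: test_function_sqr.
Qed.

(** [|f| <= f ^+ 2 + 1], and a box has finite measure. *)
Lemma L2_integrable_box a b f : L2 (obox a b) f ->
  mu.-integrable (obox a b) (EFin \o f).
Proof.
have mQ := measurable_obox a b; move=> /(L2P _ mQ)[mf fi].
have i1 : mu.-integrable (obox a b) (EFin \o (fun=> 1)).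
  apply: (@integrable_bounded_box _ _ _ _ a b 1) => //.
  - by move=> x _; rewrite normr1.
  - move=> x xab; case=> i; have /andP[h1 h2] := xab i; by rewrite in_itv/= !ltW.
apply: (@integrable_le _ _ (fun x => 1 * f x ^+ 2 + 1 * 1)) => //; first exact: integrable_lin.
move=> x _; rewrite !mul1r -(real_normK (num_real (f x))).
have := sqr_ge0 (`|f x| - 1); have := sqr_ge0 (`|f x| + 1); nra.
Qed.

Section fundamental_lemma.
Variables (W : set 'rV[R]_n) (oW : open W) (u : 'rV[R]_n -> R).
Hypotheses (uL2 : L2 W u)
  (u0 : forall phi, test_function W phi -> \int[mu]_(x in W) (u x * phi x) = 0).

Let mW : measurable W. Proof. exact: open_measurable_rV. Qed.

Lemma obox_sub_cbox (a b : 'rV[R]_n) : obox a b `<=` cbox a b.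
Proof. move=> x xab i; have /andP[h1 h2] := xab i. by rewrite in_itv/= (ltW h1) (ltW h2). Qed.

(** Test [u] against [box_bump a b N] and let [N] grow: [|u|] is an integrable majorant on the
    box. *)
Lemma integral_obox_eq0 (a b : 'rV[R]_n) : cbox a b `<=` W ->
  (\int[mu]_(x in obox a b) (u x)%:E = 0)%E.
Proof.
move=> abW; have QW : obox a b `<=` W := subset_trans (@obox_sub_cbox a b) abW.
have mQ := measurable_obox a b.
have uQ := L2_integrable_box (L2_subset mW mQ QW uL2).
have muQ : measurable_fun (obox a b) u by apply/measurable_EFinP; exact: measurable_int uQ.
have tN N := test_function_box_bump N abW.
have cv : (\int[mu]_(x in obox a b) (u x * box_bump a b N x)%:E)%E @[N --> \oo] -->
    (\int[mu]_(x in obox a b) (u x)%:E)%E.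
  apply: (@dominated_cvg _ _ _ mu _ mQ (fun N x => (u x * box_bump a b N x)%:E)
    (EFin \o u) (fun x => `|(u x)%:E|%E)).
  - move=> N; apply/measurable_EFinP; apply: measurable_funM => //.
    exact: test_function_measurable (tN N).
  - move=> x abx; apply: cvg_EFin; first exact: nearW.
    rewrite -[X in _ --> X]mulr1; apply: cvgMl_tmp; exact: box_bump_cvg.
  - by [].
  - exact: integrable_abse.
  - move=> N x _; rewrite lee_fin normrM ler_piMr// ger0_norm ?box_bump_ge0//.
    exact: box_bump_le1.
have E N : (\int[mu]_(x in obox a b) (u x * box_bump a b N x)%:E = 0)%E.
  have uNi := L2M_integrable mW uL2 (test_function_L2 oW mW (tN N)).
  have := congr1 EFin (u0 (tN N)); rewrite /Rintegral fineK; last exact: integrable_fin_num.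
  apply: etrans; rewrite [LHS]integral_mkcond [RHS]integral_mkcond; apply: eq_integral => x _.
  rewrite /patch; have [xQ|xQ] := pselect (obox a b x).
    by rewrite !mem_set//; exact: QW.
  by rewrite memNset// box_bump_eq0// mulr0; case: ifP.
have EE : (fun N : nat => \int[mu]_(x in obox a b) (u x * box_bump a b N x)%:E)%E = cst 0%E.
  by apply/funext => N; exact: E.
rewrite EE in cv; exact: (cvg_unique (@ereal_hausdorff R) cv (cvg_cst _)).
Qed.

(** By the Dynkin argument the integral of [u] vanishes over every measurable part of the box, not
    only over smaller boxes, and [integral_ae_eq] concludes. *)
Lemma ae_eq0_obox (a b : 'rV[R]_n) : cbox a b `<=` W ->
  {ae mu, forall x, obox a b x -> u x = 0}.
Proof.
move=> abW; have QW : obox a b `<=` W := subset_trans (@obox_sub_cbox a b) abW.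
have mQ := measurable_obox a b.
have uQ := L2_integrable_box (L2_subset mW mQ QW uL2).
have P (S : set 'rV[R]_n) : measurable S ->
    (\int[mu]_(x in obox a b `&` S) (u x)%:E = 0)%E.
  rewrite {1}measurable_lower_sets.
  move: S; apply: (dynkin_induction measurable_lower_sets setI_closed_lower_sets).
  - by rewrite setIT; exact: integral_obox_eq0.
  - move=> _ [c ->].
    rewrite (_ : _ `&` _ = obox a (\row_i Num.min (b ord0 i) (c ord0 i))).
      apply: integral_obox_eq0; apply: subset_trans abW => x xabc i.
      have := xabc i; rewrite !in_itv/= mxE => /andP[-> /le_trans->//].
      by rewrite ge_min lexx.
    apply/seteqP; split => x.
      by move=> [xab xc] i; rewrite mxE lt_min xc andbT; exact: xab.
    move=> h; split=> i; have := h i; rewrite mxE lt_min => /and3P[? ? ?]//.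
    exact/andP.
  - move=> S mS S0.
    have QU : obox a b = (obox a b `&` S) `|` (obox a b `&` ~` S) by rewrite -setIUr setUv setIT.
    have := integral_obox_eq0 abW; rewrite {1}QU integral_setU_EFin//.
    + by rewrite S0 add0e.
    + exact: measurableI.
    + by apply: measurableI => //; exact: measurableC.
    + by rewrite -QU; apply/measurable_EFinP; exact: measurable_int uQ.
    + by apply/disj_set2P; rewrite setIACA setICr setI0.
  - move=> F mF tF F0; rewrite setI_bigcupr integral_bigcup//.
    + by rewrite eseries0// => i _ _; exact: F0.
    + exact: trivIset_setIl.
    + by move=> k; exact: measurableI.
    + rewrite -setI_bigcupr; apply: integrableS uQ => //.
      by apply: measurableI => //; exact: bigcupT_measurable.
have := @integral_ae_eq _ _ _ mu _ mQ (cst 0%E) _ uQ (@measurable_cst _ _ _ _ _ _).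
have H (E : set 'rV[R]_n) : E `<=` obox a b -> measurable E ->
    (\int[mu]_(x in E) (EFin \o u) x = \int[mu]_(x in E) cst 0 x)%E.
  move=> EQ mE; rewrite integral0; have := P E mE.
  by rewrite setIidr.
move=> /(_ H); apply: filterS => x h Qx.
exact: EFin_inj (h Qx).
Qed.

(** The exceptional sets of the rational boxes with closure in [W] are enumerated through
    [unpickle]; their countable union is negligible. *)
Lemma fundamental_lemma : {ae mu, forall x, W x -> u x = 0}.
Proof.
have P p : mu.-negligible ((if `[< cbox (map_mx ratr p.1) (map_mx ratr p.2) `<=` W >]
    then obox (map_mx ratr p.1) (map_mx ratr p.2) else set0) `&` [set x | u x <> 0]).
  case: ifPn => [/asboolP /ae_eq0_obox|_]; last by rewrite set0I; exact: negligible_set0.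
  by apply: negligibleS => x [abx ux] /= h; apply: ux; exact: h.
pose F (k : nat) := if unpickle k is Some p then
  (if `[< cbox (map_mx ratr p.1) (map_mx ratr p.2) `<=` W >]
    then obox (map_mx ratr p.1) (map_mx ratr p.2) else set0) `&` [set x | u x <> 0] else set0.
have FN k : mu.-negligible (F k).
  by rewrite /F; case: unpickle => [p|]; [exact: P|exact: negligible_set0].
apply: negligibleS (negligible_bigcup FN) => x /= /not_implyP[Wx ux].
have [p [px pW]] := open_rat_box oW Wx.
by exists (pickle p) => //; rewrite /F pickleK asboolT.
Qed.

End fundamental_lemma.

Lemma weak_derivative_unique W (Y : 'rV[R]_n -> 'rV[R]_n) u v1 v2 : open W ->
  L2 W v1 -> L2 W v2 -> weak_derivative W Y u v1 -> weak_derivative W Y u v2 ->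
  {ae mu, forall x, W x -> v1 x = v2 x}.
Proof.
move=> oW L1 L2' w1 w2; have mW := open_measurable_rV oW.
have := @fundamental_lemma W oW (fun x => 1 * v1 x + - 1 * v2 x) (L2_lin _ _ mW L1 L2').
have H phi : test_function W phi ->
    \int[mu]_(x in W) ((1 * v1 x + - 1 * v2 x) * phi x) = 0.
  move=> tp; have pL := test_function_L2 oW mW tp.
  have -> : \int[mu]_(x in W) ((1 * v1 x + - 1 * v2 x) * phi x) =
     \int[mu]_(x in W) (1 * (v1 x * phi x) + -1 * (v2 x * phi x)).
    by apply: eq_Rintegral => x _; ring.
  rewrite Rintegral_lin//; [|exact: L2M_integrable..].
  by rewrite w1// w2// mulN1r mul1r subrr.
move=> /(_ H); apply: filterS => x h Wx; have := h Wx; lra.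
Qed.

End square_integrable.

(** * The space H10 and the first eigenvalue *)

Section sobolev_theory.
Context {R : realType} {n m : nat}.
Variables (X : 'I_m -> 'rV[R]_n -> 'rV[R]_n) (W Omega : set 'rV[R]_n).
Hypotheses (oW : open W) (sX : forall j, smooth_field W (X j)).
Local Notation mu := (lebesgue_rV n).
Implicit Types (A : set 'rV[R]_n) (u v phi : 'rV[R]_n -> R).

Let mW : measurable W. Proof. exact: open_measurable_rV. Qed.

Lemma weak_derivative_lin Y u1 u2 v1 v2 (c d : R) : smooth_field W Y ->
  L2 W u1 -> L2 W u2 -> L2 W v1 -> L2 W v2 ->
  weak_derivative W Y u1 v1 -> weak_derivative W Y u2 v2 ->
  weak_derivative W Y (fun x => c * u1 x + d * u2 x) (fun x => c * v1 x + d * v2 x).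
Proof.
move=> sY Lu1 Lu2 Lv1 Lv2 w1 w2 phi tp.
have pL := test_function_L2 oW mW tp.
have aL : L2 W (formal_adjoint Y phi).
  apply: (test_function_L2 oW mW).
  rewrite (_ : formal_adjoint Y phi = fun x => -1 *
      \sum_k partial (fun y => Y y ord0 k * phi y) k x); last first.
    by apply/funext => x; rewrite mulN1r.
  apply: test_functionZ; apply: test_function_sum => k; apply: test_function_partial.
  by apply: test_functionM.
have -> : \int[mu]_(x in W) ((c * v1 x + d * v2 x) * phi x) =
    \int[mu]_(x in W) (c * (v1 x * phi x) + d * (v2 x * phi x)).
  by apply: eq_Rintegral => x _; ring.
rewrite Rintegral_lin//; [|exact: L2M_integrable..].
rewrite w1// w2// -Rintegral_lin//; [|exact: L2M_integrable..].
by apply: eq_Rintegral => x _; ring.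
Qed.

(** [get] satisfies its predicate only if a witness exists, and [H1] provides one. *)
Lemma alongP u j : H1 X W u ->
  L2 W (along W (X j) u) /\ weak_derivative W (X j) u (along W (X j) u).
Proof.
move=> [_ /(_ j)[v Lv wv]].
exact: (@getPex _ [set v | L2 W v /\ weak_derivative W (X j) u v] (ex_intro _ v (conj Lv wv))).
Qed.

Lemma along_ae u j v : H1 X W u -> L2 W v -> weak_derivative W (X j) u v ->
  {ae mu, forall x, W x -> along W (X j) u x = v x}.
Proof.
by move=> H1u Lv wv; have [La wa] := alongP j H1u; exact: weak_derivative_unique La Lv wa wv.
Qed.

Lemma H1_lin u1 u2 (c d : R) : H1 X W u1 -> H1 X W u2 ->
  H1 X W (fun x => c * u1 x + d * u2 x).
Proof.
move=> h1 h2; split; first exact: L2_lin h1.1 h2.1.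
move=> j; have [La1 wa1] := alongP j h1; have [La2 wa2] := alongP j h2.
exists (fun x => c * along W (X j) u1 x + d * along W (X j) u2 x); first exact: L2_lin.
exact: (weak_derivative_lin c d (sX j) h1.1 h2.1 La1 La2 wa1 wa2).
Qed.

(** Representatives are chosen for each function separately, so linearity holds only almost
    everywhere, by uniqueness of weak derivatives. *)
Lemma along_lin u1 u2 (c d : R) j : H1 X W u1 -> H1 X W u2 ->
  {ae mu, forall x, W x -> along W (X j) (fun x => c * u1 x + d * u2 x) x =
     c * along W (X j) u1 x + d * along W (X j) u2 x}.
Proof.
move=> h1 h2; have [La1 wa1] := alongP j h1; have [La2 wa2] := alongP j h2.
apply: along_ae; first exact: H1_lin.
  exact: L2_lin.
exact: (weak_derivative_lin c d (sX j) h1.1 h2.1 La1 La2 wa1 wa2).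
Qed.

Lemma test_function_weak_derivative phi j : test_function W phi ->
  L2 W (field_derive (X j) phi) /\ weak_derivative W (X j) phi (field_derive (X j) phi).
Proof.
move=> tp; have td := test_function_field_derive oW (sX j) tp.
split; first exact: test_function_L2 td.
move=> psi tpsi; have [spsi _ _] := tpsi.
have spW : smooth_on W psi := smooth_on_subset (@subsetT _ _) spsi.
have ibp := integration_by_parts_field oW (sX j) tp spW.
rewrite (Rintegral_test_function (A := W))//; last first.
  under eq_fun do rewrite mulrC.
  exact: test_functionM.
rewrite [RHS](Rintegral_test_function (A := W))//; last first.
  under eq_fun do rewrite mulrC.
  by apply: test_functionM => //; exact: smooth_formal_adjoint.
under eq_Rintegral do rewrite mulrC.
under [RHS]eq_Rintegral do rewrite mulrC.
exact: ibp.
Qed.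

Lemma test_function_H1 phi : test_function W phi -> H1 X W phi.
Proof.
move=> tp; split; first exact: test_function_L2 tp.
move=> j; have [L w] := test_function_weak_derivative j tp.
by exists (field_derive (X j) phi).
Qed.

Lemma integrable_sqgrad u A : measurable A -> A `<=` W -> H1 X W u ->
  mu.-integrable A (EFin \o sqgrad X W u).
Proof.
move=> mA AW h; have E : EFin \o sqgrad X W u =
    (fun x => \sum_(j < m) (along W (X j) u x ^+ 2)%:E)%E.
  apply/funext => x; rewrite /= /sqgrad -sumEFin; apply: eq_bigr => j _.
  by rewrite real_normK ?num_real.
rewrite E; apply: integrable_sum => // j _.
by have [La _] := alongP j h; apply: (integrableS mW) => //; exact: L2_integrable_sqr.
Qed.

Lemma ae_eq_Rintegral A f g : measurable A -> measurable_fun A f -> measurable_fun A g ->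
  {ae mu, forall x, A x -> f x = g x} ->
  \int[mu]_(x in A) f x = \int[mu]_(x in A) g x.
Proof.
move=> mA mf mg fg; congr fine; apply: ae_eq_integral => //; [exact/measurable_EFinP..|].
by apply: filterS fg => x h Ax; rewrite h.
Qed.

Lemma measurable_along u j A : A `<=` W -> H1 X W u -> measurable_fun A (along W (X j) u).
Proof. by move=> AW /(alongP j)[[ma _] _]; exact: measurable_funS ma. Qed.

Lemma sqgradE u (F : 'I_m -> 'rV[R]_n -> R) A : measurable A -> A `<=` W -> H1 X W u ->
  (forall j, measurable_fun A (F j)) ->
  (forall j, {ae mu, forall x, W x -> along W (X j) u x = F j x}) ->
  \int[mu]_(x in A) sqgrad X W u x = \int[mu]_(x in A) \sum_j F j x ^+ 2.
Proof.
move=> mA AW h mF aF; apply: ae_eq_Rintegral => //.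
- by apply/measurable_EFinP; exact: measurable_int (integrable_sqgrad mA AW h).
- by apply: measurable_sum => j; apply: measurable_funX.
have : {ae mu, forall x, forall j, W x -> along W (X j) u x = F j x} by exact: filter_forall.
apply: filterS => x hx Ax; apply: eq_bigr => j _.
by rewrite real_normK ?num_real// hx//; exact: AW.
Qed.

Lemma sqgrad_ge0 u x : 0 <= sqgrad X W u x.
Proof. by apply: sumr_ge0 => j _; exact: sqr_ge0. Qed.

Lemma energy_ge0 A u : 0 <= energy X W A u.
Proof. by apply: Rintegral_ge0 => x _; exact: sqgrad_ge0. Qed.

Lemma energyZ A u (c : R) : measurable A -> A `<=` W -> H1 X W u ->
  energy X W A (fun x => c * u x) = c ^+ 2 * energy X W A u.
Proof.
move=> mA AW h; have E : (fun x => c * u x) = (fun x => c * u x + 0 * u x).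
  by apply/funext => x; rewrite mul0r addr0.
have hc : H1 X W (fun x => c * u x) by rewrite E; exact: H1_lin.
rewrite /energy (@sqgradE _ (fun j x => c * along W (X j) u x))//.
- rewrite -RintegralZl//; last exact: integrable_sqgrad.
  apply: eq_Rintegral => x _; rewrite /sqgrad mulr_sumr; apply: eq_bigr => j _.
  by rewrite exprMn real_normK ?num_real.
- by move=> j; apply: measurable_funM => //; exact: measurable_along.
- move=> j; rewrite E; apply: filterS (along_lin c 0 j h h) => x hx Wx.
  by rewrite hx// mul0r addr0.
Qed.

Lemma sqr_L2norm A u : L2norm A u ^+ 2 = \int[mu]_(x in A) `|u x| ^+ 2.
Proof. by rewrite sqr_sqrtr//; apply: Rintegral_ge0 => x _; exact: sqr_ge0. Qed.

Lemma L2normZ A u (c : R) : measurable A -> L2 A u ->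
  L2norm A (fun x => c * u x) = `|c| * L2norm A u.
Proof.
move=> mA Lu; rewrite /L2norm -(sqrtr_sqr c) -sqrtrM ?sqr_ge0//; congr Num.sqrt.
rewrite -RintegralZl//; last first.
  apply: eq_integrable (L2_integrable_sqr mA Lu) => // x _.
  by rewrite /= real_normK ?num_real.
by apply: eq_Rintegral => x _; rewrite normrM exprMn real_normK ?num_real.
Qed.

Lemma H1normZ u (c : R) : H1 X W u -> H1norm X W (fun x => c * u x) = `|c| * H1norm X W u.
Proof.
move=> h; rewrite /H1norm L2normZ//; last exact: h.1.
rewrite energyZ// exprMn real_normK ?num_real// -mulrDr -(sqrtr_sqr c).
by rewrite sqrtrM// sqr_ge0.
Qed.

Hypotheses (oO : open Omega) (OW : Omega `<=` W).

Let mO : measurable Omega. Proof. exact: open_measurable_rV. Qed.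

Lemma subfE u v : u \- v = (fun x => 1 * u x + -1 * v x).
Proof. by apply/funext => x /=; ring. Qed.

Lemma H1B u v : H1 X W u -> H1 X W v -> H1 X W (u \- v).
Proof. by move=> hu hv; rewrite subfE; exact: H1_lin. Qed.

Lemma H10Z u (c : R) : H10 X W Omega u -> H10 X W Omega (fun x => c * u x).
Proof.
move=> [h hu]; have E : (fun x => c * u x) = (fun x => c * u x + 0 * u x).
  by apply/funext => x; rewrite mul0r addr0.
split; first by rewrite E; exact: H1_lin.
move=> e e0; have c1 : 0 < `|c| + 1 by rewrite ltr_wpDl.
have [phi tp hphi] := hu _ (divr_gt0 e0 c1).
exists (fun x => c * phi x); first exact: test_functionZ.
rewrite (_ : _ \- _ = fun x => c * (u \- phi) x); last first.
  by apply/funext => x /=; rewrite mulrBr.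
have hw : H1 X W (u \- phi).
  by apply: H1B => //; apply: test_function_H1; exact: test_function_subset tp.
rewrite H1normZ//; move: hphi; rewrite ltr_pdivlMr// => hphi.
by rewrite (le_lt_trans _ hphi)// mulrC ler_wpM2l ?sqrtr_ge0// lerDl.
Qed.

Lemma test_function_H10 phi : test_function Omega phi -> H10 X W Omega phi.
Proof.
move=> tp; have tW := test_function_subset OW tp; have h := test_function_H1 tW.
split=> // e e0; exists phi => //.
rewrite (_ : _ \- _ = fun x => 0 * phi x); last by apply/funext => x /=; rewrite subrr mul0r.
by rewrite H1normZ// normr0 mul0r.
Qed.

Lemma le_Rintegral_subset A B f : measurable A -> measurable B -> A `<=` B ->
  (forall x, 0 <= f x) -> mu.-integrable B (EFin \o f) ->
  \int[mu]_(x in A) f x <= \int[mu]_(x in B) f x.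
Proof.
move=> mA mB AB f0 fB; have fA := integrableS mB mA AB fB.
rewrite /Rintegral fine_le//; [exact: integrable_fin_num|exact: integrable_fin_num|].
apply: ge0_subset_integral => //; first exact: measurable_int fB.
by move=> x _; rewrite lee_fin.
Qed.

(** The 4 is the product of two losses in [(a + b) ^+ 2 <= 2 * a ^+ 2 + 2 * b ^+ 2], one for the
    function and one for its derivatives. *)
Lemma poincare_bookkeeping (C d U Iw Ip T Eu Ew IwW EwW : R) : 0 < C ->
  IwW + EwW <= d -> Iw <= IwW -> Ew <= EwW -> 0 <= EwW -> 0 <= IwW ->
  U <= 2 * Iw + 2 * Ip -> Ip <= C * T -> T <= 2 * Eu + 2 * Ew ->
  U <= 4 * C * Eu + (2 + 4 * C) * d.
Proof.
move=> C0 hd hw hE E0 I0 hU hI hT.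
have h1 : C * T <= C * (2 * Eu + 2 * Ew) by rewrite ler_pM2l.
have h2 : C * Ew <= C * d by rewrite ler_pM2l//; lra.
lra.
Qed.

(** Approximation of [u] by a test function [phi] with error [w = u - phi]. The lost factor 4 is
    harmless: this bound only makes the infimum positive, and the sharp constant comes from its
    definition. *)
Lemma poincare_H10 (C : R) u : 0 < C ->
  (forall phi, test_function Omega phi ->
    \int[mu]_x (phi x ^+ 2) <= C * \int[mu]_x test_sqgrad X phi x) ->
  H10 X W Omega u ->
  \int[mu]_(x in Omega) `|u x| ^+ 2 <= 4 * C * energy X W Omega u.
Proof.
move=> C0 hC [h hu]; apply/ler_addgt0Pr => e e0.
(* [2 + 4 * C] is the factor of the error in [poincare_bookkeeping]. Since [H1norm] is a square
   root, [phi] is taken within [Num.sqrt d]. *)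
pose d := e / (2 + 4 * C); have k0 : 0 < 2 + 4 * C by rewrite addr_gt0// mulr_gt0.
have d0 : 0 < Num.sqrt d by rewrite sqrtr_gt0 divr_gt0.
have [phi tp hphi] := hu _ d0.
have tW := test_function_subset OW tp; have hp := test_function_H1 tW.
set w := u \- phi in hphi; have hw : H1 X W w by exact: H1B.
have nrm : \int[mu]_(x in W) (w x ^+ 2) + energy X W W w <= d.
  have n0 : 0 <= L2norm W w ^+ 2 + energy X W W w by rewrite addr_ge0 ?sqr_ge0 ?energy_ge0.
  move: hphi; rewrite /H1norm ltr_sqrt ?divr_gt0// => /ltW; apply: le_trans.
  rewrite lerD2r sqr_L2norm le_eqVlt; apply/orP; left; apply/eqP.
  by apply: eq_Rintegral => x _; rewrite real_normK ?num_real.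
have Lw := L2_integrable_sqr mW hw.1.
have i_w := L2_integrable_sqr mO (L2_subset mW mO OW hw.1).
have i_u := L2_integrable_sqr mO (L2_subset mW mO OW h.1).
have i_p := L2_integrable_sqr mO (L2_subset mW mO OW hp.1).
have w1 : \int[mu]_(x in Omega) (w x ^+ 2) <= \int[mu]_(x in W) (w x ^+ 2).
  by apply: le_Rintegral_subset => // x; exact: sqr_ge0.
have w2 : energy X W Omega w <= energy X W W w.
  by apply: le_Rintegral_subset => //; [exact: sqgrad_ge0|exact: integrable_sqgrad].
have w3 : 0 <= energy X W W w by exact: energy_ge0.
have w4 : 0 <= \int[mu]_(x in W) (w x ^+ 2) by apply: Rintegral_ge0 => x _; exact: sqr_ge0.
have s1 : \int[mu]_(x in Omega) `|u x| ^+ 2 <=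
    2 * \int[mu]_(x in Omega) (w x ^+ 2) + 2 * \int[mu]_(x in Omega) (phi x ^+ 2).
  rewrite -Rintegral_lin//; apply: le_Rintegral => //.
  - by apply: eq_integrable i_u => // x _; rewrite /= real_normK ?num_real.
  - exact: integrable_lin.
  - move=> x _; rewrite real_normK ?num_real// (_ : w x = u x - phi x)// -subr_ge0.
    rewrite (_ : _ - _ = (u x - 2 * phi x) ^+ 2) ?sqr_ge0//; ring.
have sXO j : smooth_field Omega (X j) by move=> k; apply: smooth_on_subset (sX j k).
have t1 : test_function Omega (test_sqgrad X phi).
  apply: test_function_sum => j; apply: test_function_sqr => //.
  exact: test_function_field_derive.
have s2 : \int[mu]_(x in Omega) (phi x ^+ 2) <= C * \int[mu]_(x in Omega) test_sqgrad X phi x.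
  rewrite (Rintegral_test_function (A := Omega))//; last exact: test_function_sqr.
  rewrite (Rintegral_test_function (A := Omega) _ t1)//; exact: hC.
have s3 : \int[mu]_(x in Omega) test_sqgrad X phi x <=
    2 * energy X W Omega u + 2 * energy X W Omega w.
  have i1 := integrable_sqgrad mO OW h.
  have tE j : {ae mu, forall x, W x -> along W (X j) w x =
      along W (X j) u x - field_derive (X j) phi x}.
    have [Lt wt] := test_function_weak_derivative j tW.
    have := along_lin 1 (-1) j h hp; rewrite -subfE -/w.
    move=> a1; have a2 := along_ae hp Lt wt.
    apply: filterS2 a1 a2 => x e1 e2 Wx; rewrite e1// e2//; ring.
  have mF j : measurable_fun Omega (fun x => along W (X j) u x - field_derive (X j) phi x).
    apply: measurable_funB; first exact: measurable_along.
    exact: test_function_measurable (test_function_field_derive oW (sX j) tW).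
  have iG : mu.-integrable Omega (EFin \o (fun x =>
      \sum_j (along W (X j) u x - field_derive (X j) phi x) ^+ 2)).
    have E : EFin \o (fun x => \sum_j (along W (X j) u x - field_derive (X j) phi x) ^+ 2) =
        (fun x => \sum_j ((along W (X j) u x - field_derive (X j) phi x) ^+ 2)%:E)%E.
      by apply/funext => x; rewrite /= -sumEFin.
    rewrite E; apply: integrable_sum => // j _.
    have [Lt _] := test_function_weak_derivative j tW; have [La _] := alongP j h.
    apply: eq_integrable (L2_integrable_sqr mO (L2_subset mW mO OW (L2_lin 1 (-1) mW La Lt))) => //.
    by move=> x _ /=; rewrite mul1r mulN1r.
  rewrite {2}/energy (sqgradE mO OW hw mF tE) /energy -Rintegral_lin//.
  apply: le_Rintegral => //.
  - exact: test_function_integrable t1.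
  - exact: (integrable_lin 2 2 mO i1 iG).
  - move=> x _; rewrite /test_sqgrad /sqgrad !mulr_sumr -big_split/=; apply: ler_sum => j _.
    rewrite real_normK ?num_real//; move: (along _ _ _ _) (field_derive _ _ _) => a b.
    rewrite -subr_ge0 (_ : _ - _ = (2 * a - b) ^+ 2) ?sqr_ge0//; ring.
have -> : e = (2 + 4 * C) * d by rewrite /d mulrC divfK// gt_eqF.
exact: (poincare_bookkeeping C0 nrm w1 w2 w3 w4 s1 s2 s3).
Qed.

End sobolev_theory.

(** * Admissible functions and the first eigenvalue *)

(** The infimum of the empty set is 0 by convention, so positivity of [lambda1] needs an admissible
    function. A box bump is normalized; its norm is nonzero because boxes have positive volume. *)
Lemma exists_test_function_normalized (R : realType) (n : nat) (Omega : set 'rV[R]_n) :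
  open Omega -> Omega !=set0 ->
  exists2 phi, test_function Omega phi & L2norm Omega phi = 1.
Proof.
move=> oO [x0 Ox0]; have mO := open_measurable_rV oO.
have [p [px pO]] := open_rat_box oO Ox0.
move: (map_mx _ p.1) (map_mx _ p.2) px pO => a b px pO.
have ab i : a ord0 i < b ord0 i by have /andP[h1 h2] := px i; exact: lt_trans h1 h2.
pose phi := box_bump a b 0.
have tp : test_function Omega phi by exact: test_function_box_bump.
have L := test_function_L2 oO mO tp.
suff n0 : L2norm Omega phi != 0.
  exists (fun x => (L2norm Omega phi)^-1 * phi x); first exact: test_functionZ.
  by rewrite L2normZ// ger0_norm ?invr_ge0 ?sqrtr_ge0// mulVf.
apply/eqP => N0.
have [_ li] := (L2P _ mO).1 L.
have I0 : (\int[lebesgue_rV n]_(x in Omega) `|(phi x ^+ 2)%:E| = 0)%E.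
  have h2 : \int[lebesgue_rV n]_(x in Omega) `|phi x| ^+ 2 = 0.
    by rewrite -sqr_L2norm N0 expr0n.
  have := congr1 EFin h2; rewrite /Rintegral fineK; last first.
    apply: integrable_fin_num => //; apply: eq_integrable li => // x _.
    by rewrite /= real_normK ?num_real.
  apply: etrans; apply: eq_integral => x _.
  by rewrite /= real_normK ?num_real// ger0_norm ?sqr_ge0.
have /(ae_eq_integral_abs _ mO)[] := I0; first exact: measurable_int li.
move=> N [mN muN NP].
(* The closed middle third of the box, where the bump is positive: if the norm were 0, it would lie
   in a null set. *)
pose a' : 'rV[R]_n := \row_i (a ord0 i + (b ord0 i - a ord0 i) / 3).
pose b' : 'rV[R]_n := \row_i (b ord0 i - (b ord0 i - a ord0 i) / 3).
have KN : cbox a' b' `<=` N.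
  move=> x xK; apply: NP => /= H.
  have xQ : obox a b x.
    move=> i; have := xK i; have := ab i; rewrite in_itv/= !mxE => h /andP[h1 h2].
    by apply/andP; split; lra.
  have Ox : Omega x by apply: pO; exact: obox_sub_cbox.
  have [] := H Ox; apply/eqP; rewrite expf_eq0/=.
  by rewrite gt_eqF// box_bump_gt0.
have a'b' i : a' ord0 i < b' ord0 i by rewrite !mxE; have := ab i; lra.
have : (lebesgue_rV n (cbox a' b') <= 0)%E.
  by rewrite -muN; apply: le_measure => //; rewrite inE//; exact: measurable_cbox.
rewrite lebesgue_rV_box; last by move=> i; exact: ltW.
rewrite lee_fin leNgt => /negP; apply; apply: prodr_gt0 => i _.
by rewrite subr_gt0.
Qed.

Theorem proposition2p1 (R : realType) (n m : nat)
    (X : 'I_m -> 'rV[R]_n -> 'rV[R]_n) (W Omega : set 'rV[R]_n)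
    (n_ge2 : (2 <= n)%N)
    (openW : open W) (connectedW : connected W)
    (smoothX : forall j, smooth_field W (X j))
    (hormanderX : hormander_condition X W)
    (Omega0 : Omega !=set0) (openOmega : open Omega)
    (connectedOmega : connected Omega)
    (boundedOmega : bounded_set Omega)
    (OmegaW : compactly_included Omega W)
    (smoothOmega : smooth_boundary Omega) :
  0 < lambda1 X W Omega /\
  forall u : 'rV[R]_n -> R, H10 X W Omega u ->
    lambda1 X W Omega * \int[lebesgue_rV n]_(x in Omega) `|u x| ^+ 2 <=
    \int[lebesgue_rV n]_(x in Omega) sqgrad X W u x.
Proof.
have OW := Omega_subW OmegaW.
have mO := open_measurable_rV openOmega; have mW := open_measurable_rV openW.
have W0 : W !=set0 by have [x /OW Wx] := Omega0; exists x.
have [C C0 hC] := poincare_test_function openW smoothX openOmega OmegaW hormanderX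
  (ltnW n_ge2) W0 connectedW.
have C40 : 0 < 4 * C by rewrite mulr_gt0.
set S := [set energy X W Omega phi | phi in
  [set phi | H10 X W Omega phi /\ L2norm Omega phi = 1]].
have S0 : S !=set0.
  have [phi tp phi1] := exists_test_function_normalized openOmega Omega0.
  exists (energy X W Omega phi), phi => //; split => //.
  exact: test_function_H10 tp.
have lbS : lbound S (4 * C)^-1.
  move=> _ [phi [hphi phi1] <-].
  have := poincare_H10 openW smoothX openOmega OW C0 hC hphi.
  by rewrite -sqr_L2norm phi1 expr1n -ler_pdivrMl// mulr1.
split; first by apply: lt_le_trans (lb_le_inf S0 lbS); rewrite invr_gt0.
move=> u hu; have Lu : L2 Omega u by apply: (L2_subset mW mO OW); exact: hu.1.1.
rewrite -/(energy X W Omega u) -sqr_L2norm.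
(* A function of zero norm cannot be normalized; its inequality reduces to nonnegativity of the
   energy. Otherwise the quotient of [u] by its norm competes in the infimum, and quadratic
   homogeneity of the energy gives the claim. *)
have [->|N0] := eqVneq (L2norm Omega u) 0.
  by rewrite expr0n mulr0; exact: energy_ge0.
have Np : 0 < L2norm Omega u by rewrite lt_def N0 sqrtr_ge0.
have : lambda1 X W Omega <= energy X W Omega (fun x => (L2norm Omega u)^-1 * u x).
  apply: ge_inf; first by exists (4 * C)^-1.
  exists (fun x => (L2norm Omega u)^-1 * u x); last by [].
  split; first exact: (H10Z openW smoothX OW _ hu).
  by rewrite L2normZ// ger0_norm ?invr_ge0 ?sqrtr_ge0// mulVf.
rewrite (energyZ openW smoothX _ mO OW hu.1).
by rewrite exprVn mulrC ler_pdivlMr ?exprn_gt0.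
Qed.
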